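(* Let $a,b,c\in\mathbb{H}$ with $M=\max\{|a|,|b|,|c|\}>0$, and suppose $|a|,|b|,|c|$ do not form a triangle, i.e. the largest of them is at least the sum of the other two. Then \[m_{\mathbb{H}}(ax+by+c)=\log M+\frac{|a|^2+|b|^2+|c|^2}{4M^2}-\frac14.\]
   Context: $\mathbb{H}$ denotes the quaternions, $\mathbb{T}^2(\mathbb{H})=\{(x,y)\in\mathbb{H}^2:|x|=|y|=1\}$ with probability Haar measure $\mu$, and $m_{\mathbb{H}}(P)=\int_{\mathbb{T}^2(\mathbb{H})}\log|P(x,y)|\,d\mu$; here $ax+by+c$ is the function $(x,y)\mapsto ax+by+c$ with quaternion multiplication. *)

(* Defs.v *)
From HB Require Import structures.
From mathcomp Require Import all_boot all_order all_algebra.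
From mathcomp Require Import all_classical all_reals all_analysis.
Set Implicit Arguments. Unset Strict Implicit. Unset Printing Implicit Defensive.
Import Order.TTheory GRing.Theory Num.Theory Num.Def.
Import numFieldNormedType.Exports.
Local Open Scope classical_set_scope.
Local Open Scope ring_scope.

Section Quaternions.
Variable R : realType.

(* A quaternion q = q0 + q1 i + q2 j + q3 k is stored as ((q0,q1),(q2,q3));
   this product type carries the product (Borel) sigma-algebra of R^4. *)
Definition quat := ((R * R) * (R * R))%type.

Definition qmk (x0 x1 x2 x3 : R) : quat := ((x0, x1), (x2, x3)).
Definition q0 (q : quat) : R := q.1.1.
Definition q1 (q : quat) : R := q.1.2.
Definition q2 (q : quat) : R := q.2.1.
Definition q3 (q : quat) : R := q.2.2.

Definition qadd (p q : quat) : quat :=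
  qmk (q0 p + q0 q) (q1 p + q1 q) (q2 p + q2 q) (q3 p + q3 q).

(* Hamilton product: i^2 = j^2 = k^2 = ijk = -1 *)
Definition qmul (p q : quat) : quat :=
  qmk (q0 p * q0 q - q1 p * q1 q - q2 p * q2 q - q3 p * q3 q)
      (q0 p * q1 q + q1 p * q0 q + q2 p * q3 q - q3 p * q2 q)
      (q0 p * q2 q - q1 p * q3 q + q2 p * q0 q + q3 p * q1 q)
      (q0 p * q3 q + q1 p * q2 q - q2 p * q1 q + q3 p * q0 q).

Definition qnorm (q : quat) : R :=
  Num.sqrt (q0 q ^+ 2 + q1 q ^+ 2 + q2 q ^+ 2 + q3 q ^+ 2).

Definition qscale (r : R) (q : quat) : quat :=
  qmk (r * q0 q) (r * q1 q) (r * q2 q) (r * q3 q).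

(* radial projection onto the unit sphere S^3 (value at 0 is irrelevant) *)
Definition qnormalize (q : quat) : quat := qscale (qnorm q)^-1 q.

Definition leb4 :=
  ((@lebesgue_measure R \x @lebesgue_measure R) \x
   (@lebesgue_measure R \x @lebesgue_measure R))%E.

Definition qball : set quat := [set q | qnorm q <= 1].

(* The probability Haar measure mu on T^2(H) = S^3 x S^3 is the image of the
   normalized Lebesgue measure on the product of unit balls qball x qball
   under (u, v) |-> (u/|u|, v/|v|).  Hence, for P : H -> H -> H,
   m_H(P) = int_{T^2(H)} log|P(x,y)| dmu(x,y)
          = (1/vol(B)^2) int_{B x B} log|P(u/|u|, v/|v|)| d(u,v). *)
Definition mahlerH (P : quat -> quat -> quat) : \bar R :=
  ((\int[(leb4 \x leb4)%E]_(z in qball `*` qball)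
      (ln (qnorm (P (qnormalize z.1) (qnormalize z.2))))%:E)
   * ((fine (leb4 qball)) ^- 2)%:E)%E.

Definition linpoly (a b c : quat) : quat -> quat -> quat :=
  fun x y => qadd (qadd (qmul a x) (qmul b y)) c.

End Quaternions.

(* Main.v *)
(* If x is uniform on the unit sphere of H and |p| = S >= r = |q|, then log|x p + q|
   has mean log S + r^2/(4 S^2).  Indeed |x p + q|^2 = S^2 + r^2 + 2 S r Re(g x) for some
   unit g, and left multiplication by g preserves the law of x.  For r < S expand
   log(1 + 2 rho t + rho^2), t = Re x, in Chebyshev polynomials T_n(t): invariance gives
   E[(1 - t^2) f'(t) - 3 t f(t)] = 0 for polynomials f, and f = T_(n+1) yields
   (n - 2) E T_n = (n + 4) E T_(n+2), so that only E T_0 = 1 and E T_2 = -1/2 survive.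
   The case r = S follows by monotone convergence as rho increases to 1.
   By invariance a and b may be replaced by |a| and |b|.  If |a| is the largest, integrate
   in x first and then use E|b y + c|^2 = |b|^2 + |c|^2; |b| is symmetric.  If |c| is the
   largest, replace y by x y, so that a x + b x y + c = x (a + b y) + c, and integrate in x.
   Integrability comes for free from Tonelli's theorem applied to C - log|a x + b y + c|
   with C an upper bound. *)
Require Import Defs.
From HB Require Import structures.
From mathcomp Require Import all_boot all_order all_algebra.
From mathcomp Require Import all_classical all_reals all_analysis.
From mathcomp Require Import measurable_realfun ring lra.
Import Order.TTheory GRing.Theory Num.Theory Num.Def.
Import numFieldNormedType.Exports.
Local Open Scope classical_set_scope.
Local Open Scope ring_scope.

(** * Shears of product measures *)

(** Every use of invariance rests on one fact: left multiplication by a unit quaternion preserves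
    Lebesgue measure on R^4. This linear map factors into block shears, and a shear is a translation
    on each fibre, so Tonelli reduces the fact to translation invariance on the line. The identity
    E[(1 - t^2) f'(t) - 3 t f(t)] = 0 is in turn a recursion between the moments of the real part.
    It comes from applying invariance to the multipliers 1 - t i, 1 - t j, 1 - t k: they are not
    units, but they scale the norm by sqrt(1 + t^2), and both sides are polynomials in t.

    The delicate case is r = S. There log|x p + q| is unbounded, [ln 0] is 0 instead of minus
    infinity, and log(1 + 2 rho t + rho^2) is not monotone in rho for negative t. A null set is
    removed, and the argument is divided by rho before the limit is taken. *)

Definition mpreserving {d} {T : measurableType d} {R : realType}
    (m : set T -> \bar R) (f : T -> T) : Prop :=
  measurable_fun [set: T] f /\
  forall h : T -> \bar R, measurable_fun [set: T] h -> (forall x, 0 <= h x)%E ->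
    (\int[m]_x h (f x) = \int[m]_x h x)%E.

Lemma mpreserving_comp {d} {T : measurableType d} {R : realType}
    (m : set T -> \bar R) (f g : T -> T) :
  mpreserving m f -> mpreserving m g -> mpreserving m (f \o g).
Proof.
move=> [mf If] [mg Ig]; split; first exact: measurableT_comp.
move=> h mh h0; rewrite -(If h mh h0) -[RHS](Ig (h \o f))//.
  exact: measurableT_comp.
by move=> x; exact: h0.
Qed.

(** The first coordinate is untouched, so by Tonelli it suffices that each fibre map preserves
    [m2]. *)
Lemma mpreserving_shear2 {d1 d2} {T1 : measurableType d1} {T2 : measurableType d2}
    {R : realType} (m1 : {sigma_finite_measure set T1 -> \bar R})
    (m2 : {sigma_finite_measure set T2 -> \bar R}) (F : T1 * T2 -> T2) :
  measurable_fun [set: T1 * T2] F -> (forall x, mpreserving m2 (fun y => F (x, y))) ->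
  mpreserving (m1 \x m2)%E (fun z => (z.1, F z)).
Proof.
move=> mF pF; have mG : measurable_fun [set: T1 * T2] (fun z => (z.1, F z)).
  by apply: measurable_fun_pair => //; exact: measurable_fst.
split=> // h mh h0.
rewrite (fubini_tonelli1 _ (measurableT_comp mh mG) (fun z => h0 _)).
rewrite (fubini_tonelli1 h mh h0); apply: eq_integral => x _.
have [_ pFx] := pF x; apply: (pFx (fun y => h (x, y))) => //.
exact: measurable_fun_pair2.
Qed.

Lemma mpreserving_shear1 {d1 d2} {T1 : measurableType d1} {T2 : measurableType d2}
    {R : realType} (m1 : {sigma_finite_measure set T1 -> \bar R})
    (m2 : {sigma_finite_measure set T2 -> \bar R}) (F : T1 * T2 -> T1) :
  measurable_fun [set: T1 * T2] F -> (forall y, mpreserving m1 (fun x => F (x, y))) ->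
  mpreserving (m1 \x m2)%E (fun z => (F z, z.2)).
Proof.
move=> mF pF; have mG : measurable_fun [set: T1 * T2] (fun z => (F z, z.2)).
  by apply: measurable_fun_pair => //; exact: measurable_snd.
split=> // h mh h0.
rewrite (fubini_tonelli2 _ (measurableT_comp mh mG) (fun z => h0 _)).
rewrite (fubini_tonelli2 h mh h0); apply: eq_integral => y _.
have [_ pFy] := pF y; apply: (pFy (fun x => h (x, y))) => //.
exact: measurable_fun_pair1.
Qed.

(** The rectangles F_i x G_j cover the product and have finite measure. They are enumerated by
    decoding n into a pair, with the empty set for an n that codes none. *)
Lemma product_measure_sigma_finite {d1 d2} {T1 : measurableType d1}
    {T2 : measurableType d2} {R : realType}
    (m1 : {sigma_finite_measure set T1 -> \bar R})
    (m2 : {sigma_finite_measure set T2 -> \bar R}) :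
  sigma_finite setT (m1 \x m2)%E.
Proof.
have [F TF Foo] := sigma_finiteT m1.
have [G TG Goo] := sigma_finiteT m2.
pose k n : option (nat * nat) := pickle_inv n.
exists (fun n => if k n is Some ij then F ij.1 `*` G ij.2 else set0).
  apply/seteqP; split=> // -[x y] _.
  have [i _ Fx] : (\bigcup_i F i) x by rewrite -TF.
  have [j _ Gy] : (\bigcup_i G i) y by rewrite -TG.
  by exists (pickle (i, j)) => //; rewrite /k pickleK_inv.
move=> n; case: (k n) => [[i j]|]; last by rewrite measure0.
have [mF Fi] := Foo i; have [mG Gi] := Goo j.
split; first exact: measurableX.
by rewrite product_measure1E// lte_mul_pinfty// ge0_fin_numE.
Qed.

(* The library's sigma-finite structure on [m1 \x m2] is shadowed by the one for
   subprobability measures and is not inferred: this one is passed explicitly. *)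
Definition prodm {d1 d2} {T1 : measurableType d1} {T2 : measurableType d2}
    {R : realType} (m1 : {sigma_finite_measure set T1 -> \bar R})
    (m2 : {sigma_finite_measure set T2 -> \bar R}) :
    SigmaFiniteMeasure.type (T1 * T2)%type R :=
  HB.pack (m1 \x m2)%E
    (Measure_isSigmaFinite.Build _ _ _ (m1 \x m2)%E
       (product_measure_sigma_finite m1 m2)).

(** * Invariance of Lebesgue measure under unit quaternions *)

Section Leb.
Context {R : realType}.
Local Notation mR := (measurableTypeR R).
Definition lebR : {sigma_finite_measure set mR -> \bar R} := @lebesgue_measure R.
Definition leb2 := prodm lebR lebR.
Definition mleb4 := prodm leb2 leb2.

(** The image of Lebesgue measure under a translation gives each half-open interval its length,
    which characterises Lebesgue measure. *)
Lemma mpreserving_translation (a : R) : mpreserving lebR (fun x => x + a).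
Proof.
have mf : measurable_fun [set: mR] ((fun x => x + a) : mR -> mR).
  exact: measurable_funD.
split=> // h mh h0.
have /= <- := ge0_integral_pushforward mf lebR measurableT mh (fun x _ => h0 x).
apply: eq_measure_integral => A mA _.
apply/esym/lebesgue_measure_unique => // _ [[b c]] _ <-.
rewrite [RHS]/= /pushforward.
have -> : (fun x : R => x + a) @^-1` [set` `]b, c]] = [set` `]b - a, c - a]].
  by apply/seteqP; split=> x /=; rewrite !in_itv/= ltrBlDr lerBrDr.
rewrite !lebesgue_measure_itv/= !lte_fin ltrD2r; case: ifP => // _.
by rewrite -!EFinB; congr EFin; ring.
Qed.

Lemma mpreserving_translation2 (a : R * R) :
  mpreserving leb2 (fun z => (z.1 + a.1, z.2 + a.2)).
Proof.
pose f (z : mR * mR) : mR * mR := (z.1 + a.1, z.2).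
pose g (z : mR * mR) : mR * mR := (z.1, z.2 + a.2).
apply: (@mpreserving_comp _ _ _ leb2 f g).
  apply: (@mpreserving_shear1 _ _ _ _ _ lebR lebR (fun z => z.1 + a.1)).
    by apply: measurable_funD => //; exact: measurable_fst.
  by move=> y; exact: mpreserving_translation.
apply: (@mpreserving_shear2 _ _ _ _ _ lebR lebR (fun z => z.2 + a.2)).
  by apply: measurable_funD => //; exact: measurable_snd.
by move=> y; exact: mpreserving_translation.
Qed.

Lemma measurable_addp {d} {T : measurableType d} (f g : T -> mR * mR) :
  measurable_fun setT f -> measurable_fun setT g ->
  measurable_fun setT (fun x => ((f x).1 + (g x).1, (f x).2 + (g x).2)).
Proof.
move=> mf mg; apply: measurable_fun_pair; apply: measurable_funD.
- exact: (measurableT_comp measurable_fst mf).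
- exact: (measurableT_comp measurable_fst mg).
- exact: (measurableT_comp measurable_snd mf).
- exact: (measurableT_comp measurable_snd mg).
Qed.

(** A lower unipotent block shear: once z.1 is fixed it translates z.2 by a constant, so [h] need
    only be measurable. *)
Lemma mpreserving_block2 (h : mR * mR -> mR * mR) : measurable_fun setT h ->
  mpreserving mleb4 (fun z => (z.1, (z.2.1 + (h z.1).1, z.2.2 + (h z.1).2))).
Proof.
move=> mh.
apply: (@mpreserving_shear2 _ _ _ _ _ leb2 leb2
  (fun z => (z.2.1 + (h z.1).1, z.2.2 + (h z.1).2))) => [|x]; last first.
  exact: (mpreserving_translation2 (h x)).
apply: (measurable_addp snd (h \o fst)); first exact: measurable_snd.
exact: (measurableT_comp mh measurable_fst).
Qed.

Lemma mpreserving_block1 (h : mR * mR -> mR * mR) : measurable_fun setT h ->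
  mpreserving mleb4 (fun z => ((z.1.1 + (h z.2).1, z.1.2 + (h z.2).2), z.2)).
Proof.
move=> mh.
apply: (@mpreserving_shear1 _ _ _ _ _ leb2 leb2
  (fun z => (z.1.1 + (h z.2).1, z.1.2 + (h z.2).2))) => [|x]; last first.
  exact: (mpreserving_translation2 (h x)).
apply: (measurable_addp fst (h \o snd)); first exact: measurable_fst.
exact: (measurableT_comp mh measurable_snd).
Qed.

End Leb.

Section Quat.
Context {R : realType}.
Local Notation mR := (measurableTypeR R).
Local Notation Q := ((mR * mR) * (mR * mR))%type.
Implicit Types p q g : quat R.

(** The squared norm is a polynomial in the coordinates, so norm identities become polynomial
    identities without square roots. *)
Definition qsq q : R := q0 q ^+ 2 + q1 q ^+ 2 + q2 q ^+ 2 + q3 q ^+ 2.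

Lemma qsq_ge0 q : 0 <= qsq q.
Proof. by rewrite /qsq !addr_ge0// sqr_ge0. Qed.

Lemma quat_eq p q : q0 p = q0 q -> q1 p = q1 q -> q2 p = q2 q -> q3 p = q3 q ->
  p = q.
Proof.
case: p => [[? ?] [? ?]]; case: q => [[? ?] [? ?]].
by rewrite /q0 /q1 /q2 /q3 /= => -> -> -> ->.
Qed.

(** Euler's four-square identity. *)
Lemma qsqM p q : qsq (qmul p q) = qsq p * qsq q.
Proof. rewrite /qsq /qmul /qmk /q0 /q1 /q2 /q3 /=; ring. Qed.

Lemma qmulA p q g : qmul p (qmul q g) = qmul (qmul p q) g.
Proof. by apply: quat_eq; rewrite /qmul /qmk /q0 /q1 /q2 /q3 /=; ring. Qed.

Lemma measurable_q0 : measurable_fun setT (@q0 R : Q -> mR).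
Proof. exact: (measurableT_comp measurable_fst measurable_fst). Qed.
Lemma measurable_q1 : measurable_fun setT (@q1 R : Q -> mR).
Proof. exact: (measurableT_comp measurable_snd measurable_fst). Qed.
Lemma measurable_q2 : measurable_fun setT (@q2 R : Q -> mR).
Proof. exact: (measurableT_comp measurable_fst measurable_snd). Qed.
Lemma measurable_q3 : measurable_fun setT (@q3 R : Q -> mR).
Proof. exact: (measurableT_comp measurable_snd measurable_snd). Qed.

Lemma measurable_qmk {d} {T : measurableType d} (f0 f1 f2 f3 : T -> mR) :
  measurable_fun setT f0 -> measurable_fun setT f1 ->
  measurable_fun setT f2 -> measurable_fun setT f3 ->
  measurable_fun setT (fun x => qmk (f0 x) (f1 x) (f2 x) (f3 x) : Q).
Proof. by move=> *; do 2?apply: measurable_fun_pair. Qed.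

Section Coord.
Context {d} {T : measurableType d} (f g : T -> Q).
Hypotheses (mf : measurable_fun setT f) (mg : measurable_fun setT g).

Lemma measurable_q0f : measurable_fun setT (fun x => q0 (f x) : mR).
Proof. exact: (measurableT_comp measurable_q0 mf). Qed.
Lemma measurable_q1f : measurable_fun setT (fun x => q1 (f x) : mR).
Proof. exact: (measurableT_comp measurable_q1 mf). Qed.
Lemma measurable_q2f : measurable_fun setT (fun x => q2 (f x) : mR).
Proof. exact: (measurableT_comp measurable_q2 mf). Qed.
Lemma measurable_q3f : measurable_fun setT (fun x => q3 (f x) : mR).
Proof. exact: (measurableT_comp measurable_q3 mf). Qed.
End Coord.

Ltac mcoord := solve [exact: measurable_q0f | exact: measurable_q1f
  | exact: measurable_q2f | exact: measurable_q3f | exact: measurable_cst].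
Ltac mpoly := repeat first [mcoord | apply: measurable_funD | apply: measurable_funB
  | apply: measurable_funM | apply: measurable_funX | apply: measurable_funN].

Section Ops.
Context {d} {T : measurableType d} (f g : T -> Q).
Hypotheses (mf : measurable_fun setT f) (mg : measurable_fun setT g).

Lemma measurable_qadd : measurable_fun setT (fun x => qadd (f x) (g x) : Q).
Proof. by apply: measurable_qmk; mpoly. Qed.

Lemma measurable_qmul : measurable_fun setT (fun x => qmul (f x) (g x) : Q).
Proof. by apply: measurable_qmk; mpoly. Qed.

Lemma measurable_qsq : measurable_fun setT (fun x => qsq (f x) : mR).
Proof. by rewrite /qsq; mpoly. Qed.

Lemma measurable_qnorm : measurable_fun setT (fun x => qnorm (f x) : mR).
Proof.
have -> : (fun x => qnorm (f x)) = (fun x => (qsq (f x)) `^ (2^-1)).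
  by apply/funext => x; rewrite powR12_sqrt ?qsq_ge0.
exact: (measurableT_comp (measurable_powR _) measurable_qsq).
Qed.

End Ops.

Lemma measurable_qnormalize : measurable_fun setT (@qnormalize R : Q -> Q).
Proof.
have mn : measurable_fun setT (fun x : Q => (qnorm x)^-1 : mR).
  have -> : (fun x : Q => (qnorm x)^-1) = (fun x : Q => (qnorm x) `^ (-1)).
    by apply/funext => x; rewrite powR_inv1 ?sqrtr_ge0.
  apply: (measurableT_comp (measurable_powR _)).
  exact: (measurable_qnorm _ (@measurable_id _ _ _)).
have mid := @measurable_id _ Q setT.
by apply: measurable_qmk; apply: measurable_funM => //; mcoord.
Qed.

(* With q = z + w j, z and w complex, left multiplication by a unit g = u + v j is
   the 2x2 block matrix (A B; C D) with C z = v z^*, and if v <> 0 it is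
   (1 X; 0 1) (1 0; C 1) (1 Z; 0 1), X = (A - 1) C^-1, Z = C^-1 (D - 1). *)
Let mpreserving_qmul_aux g : q2 g ^+ 2 + q3 g ^+ 2 != 0 -> qsq g = 1 ->
  mpreserving mleb4 (qmul g : Q -> Q).
Proof.
move: g => [[a b] [c d]]; rewrite /qsq /q0 /q1 /q2 /q3 /= => n0 g1.
pose n := c ^+ 2 + d ^+ 2.
pose C (z : mR * mR) : mR * mR := (c * z.1 + d * z.2, d * z.1 - c * z.2).
(* The matrix of [C] squares to n, so [I] = [C] / n is its inverse. [A] below is multiplication by u
   - 1; it serves both X and Z because both diagonal blocks are multiplication by u. *)
pose I (z : mR * mR) : mR * mR := ((c * z.1 + d * z.2) / n, (d * z.1 - c * z.2) / n).
pose A (z : mR * mR) : mR * mR := ((a - 1) * z.1 - b * z.2, b * z.1 + (a - 1) * z.2).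
have mlin (u v u' v' : R) : measurable_fun setT
    ((fun z => (u * z.1 + v * z.2, u' * z.1 + v' * z.2)) : mR * mR -> mR * mR).
  apply: measurable_fun_pair; apply: measurable_funD; apply: measurable_funM => //;
    solve [exact: measurable_fst|exact: measurable_snd|exact: measurable_cst].
have mC : measurable_fun setT C.
  rewrite (_ : C = fun z => (c * z.1 + d * z.2, d * z.1 + (- c) * z.2)) //.
  by apply/funext => z; rewrite /C mulNr.
have mI : measurable_fun setT I.
  rewrite (_ : I = fun z => (c / n * z.1 + d / n * z.2, d / n * z.1 + (- c / n) * z.2)) //.
  by apply/funext => z; rewrite /I; congr pair; ring.
have mA : measurable_fun setT A.
  rewrite (_ : A = fun z => ((a - 1) * z.1 + (- b) * z.2, b * z.1 + (a - 1) * z.2)) //.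
  by apply/funext => z; rewrite /A mulNr.
have pU := mpreserving_block1 _ (measurableT_comp mA mI).
have pL := mpreserving_block2 _ mC.
have pZ := mpreserving_block1 _ (measurableT_comp mI mA).
have := mpreserving_comp _ _ _ pU (mpreserving_comp _ _ _ pL pZ).
congr mpreserving; apply/funext => -[[x y] [z w]].
rewrite /qmul /qmk /q0 /q1 /q2 /q3 /C /I /A /n /=.
(* The unit norm matters in the upper right block, which sends w to v (|u|^2 - 1) / |v|^2 times conj
   w, that is, to - v conj w. *)
have a2 : a ^+ 2 = 1 - b ^+ 2 - c ^+ 2 - d ^+ 2 by rewrite -g1; ring.
by congr pair; congr pair; field: a2.
Qed.

Lemma mpreserving_qmul g : qsq g = 1 -> mpreserving mleb4 (qmul g : Q -> Q).
Proof.
move=> g1; have [n0|] := eqVneq (q2 g ^+ 2 + q3 g ^+ 2) 0; last first.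
  by move=> n0; exact: mpreserving_qmul_aux.
have /andP[/eqP g2 /eqP g3] : (q2 g == 0) && (q3 g == 0).
  by move/eqP: n0; rewrite paddr_eq0 ?sqr_ge0// !sqrf_eq0.
(* If g is complex, then g = j h with h = - j g, and both factors have a nonzero component along j
   or k. *)
pose j := qmk 0 0 1 0 : quat R; pose h := qmk 0 0 (- q0 g) (q1 g).
have -> : qmul g = qmul j \o qmul h.
  apply/funext => x /=; rewrite qmulA; congr (qmul _ x).
  by apply: quat_eq; rewrite /qmul /qmk /= /q0 /q1 /q2 /q3 /=;
    rewrite ?[g.2.1]g2 ?[g.2.2]g3; ring.
have h1 : qsq h = 1.
  by rewrite -g1 /qsq g2 g3 /h /qmk /q0 /q1 /q2 /q3 /=; ring.
have j1 : qsq j = 1 by rewrite /qsq /j /qmk /q0 /q1 /q2 /q3 /=; ring.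
apply: (@mpreserving_comp _ Q).
  by apply: mpreserving_qmul_aux; rewrite // /j /qmk /q2 /q3 /= expr1n expr0n addr0 oner_eq0.
apply: mpreserving_qmul_aux => //.
have -> : q2 h ^+ 2 + q3 h ^+ 2 = qsq h.
  by rewrite /qsq (_ : q0 h = 0)// (_ : q1 h = 0)//; ring.
by rewrite h1 oner_eq0.
Qed.

End Quat.

(** * The rotation-invariant measure on the three-sphere *)

Lemma ge0_integral_mrestr {d} {T : measurableType d} {R : realType}
    (m : {measure set T -> \bar R}) (D : set T) (mD : measurable D)
    (f : T -> \bar R) : measurable_fun setT f -> (forall x, 0 <= f x)%E ->
  (\int[mrestr m mD]_x f x = \int[m]_(x in D) f x)%E.
Proof.
move=> mf f0; have mDC : measurable (~` D) by exact: measurableC.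
have D0 : mrestr m mD (~` D) = 0%E by rewrite /mrestr setICl measure0.
rewrite (ge0_negligible_integral mDC measurableT mf (fun x _ => f0 x) D0).
rewrite setTD setCK; apply: eq_measure_integral => A mA AD /=.
by rewrite /mrestr setIidl.
Qed.

Section Pushrestr.
Context {d d'} {T : measurableType d} {T' : measurableType d'} {R : realType}.
Variables (m : {measure set T -> \bar R}) (D : set T) (f : T -> T').
Hypotheses (mD : measurable D) (mf : measurable_fun setT f).

Definition pushrestr_measure : Measure.type T' R :=
  measure_function_pushforward__canonical__measure_function_Measure
    (mrestr m mD) mf.

Lemma ge0_integral_pushrestr (h : T' -> \bar R) :
  measurable_fun setT h -> (forall x, 0 <= h x)%E ->
  (\int[pushrestr_measure]_x h x = \int[m]_(x in D) h (f x))%E.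
Proof.
move=> mh h0; rewrite /pushrestr_measure /=.
rewrite (ge0_integral_pushforward mf (mrestr m mD) measurableT mh (fun x _ => h0 x)).
rewrite preimage_setT ge0_integral_mrestr//.
  exact: measurableT_comp.
by move=> x; exact: h0.
Qed.

Hypothesis Dlty : (m D < +oo)%E.

Let fin_num_pushrestr : fin_num_fun pushrestr_measure.
Proof.
move=> A mA; rewrite ge0_fin_numE ?measure_ge0//.
apply: le_lt_trans Dlty; rewrite /= /pushforward /mrestr.
apply: le_measure; rewrite ?inE//; apply: measurableI => //.
by rewrite -[X in measurable X]setTI; exact: mf.
Qed.

Definition pushrestr : FiniteMeasure.type T' R :=
  HB.pack (pushrestr_measure : set T' -> \bar R) (Measure.on pushrestr_measure)
    (Measure_isFinite.Build _ _ _ pushrestr_measure fin_num_pushrestr).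

End Pushrestr.

Section Sphere.
Context {R : realType}.
Local Notation mR := (measurableTypeR R).
Local Notation Q := ((mR * mR) * (mR * mR))%type.

Lemma qball_qsq (q : quat R) : @qball R q <-> qsq q <= 1.
Proof.
rewrite /qball /= /qnorm -/(qsq q) -[X in _ <= X <-> _]sqrtr1.
by rewrite ler_psqrt// ?qualifE/= ?qsq_ge0.
Qed.

Lemma measurable_qball : measurable (@qball R : set Q).
Proof.
have m : measurable_fun setT (fun q : Q => qnorm q : mR).
  exact: (measurable_qnorm _ (@measurable_id _ _ _)).
rewrite -[X in measurable X]setTI.
rewrite (_ : @qball R = (fun q : Q => qnorm q) @^-1` [set` `]-oo, 1]]).
  by apply: m => //; exact: measurable_itv.
by apply/seteqP; split=> q /=; rewrite in_itv.
Qed.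

(** Cubes of half-side 1/2 and 1 enclose the unit ball from inside and outside (four squares of at
    most 1/4 add up to at most 1). Hence its volume is positive and finite; the exact value never
    matters. *)
Let cube (r : R) : set Q :=
  ([set` `[- r, r]] `*` [set` `[- r, r]]) `*` ([set` `[- r, r]] `*` [set` `[- r, r]]).

Let mleb4_cube (r : R) : 0 < r -> mleb4 (cube r) = ((2 * r) ^+ 4)%:E.
Proof.
move=> r0; have mI : measurable ([set` `[- r, r]] : set mR) by exact: measurable_itv.
have lI : lebR ([set` `[- r, r]] : set mR) = (2 * r)%:E.
  have /= -> := lebesgue_measure_itv `[- r, r].
  rewrite lte_fin ltrNl (lt_trans _ r0) ?oppr_lt0//.
  by rewrite -EFinB opprK; congr EFin; ring.
have l2 : leb2 ([set` `[- r, r]] `*` [set` `[- r, r]]) = ((2 * r) ^+ 2)%:E.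
  have := @product_measure1E _ _ _ _ R lebR lebR _ _ mI mI.
  by rewrite /leb2 /prodm /= lI -EFinM -expr2.
have mII := measurableX mI mI.
have := @product_measure1E _ _ _ _ R leb2 leb2 _ _ mII mII.
by rewrite /mleb4 {1}/prodm /= l2 -EFinM => ->; congr EFin; ring.
Qed.

Let mcube r : measurable (cube r).
Proof. by do 2?apply: measurableX; exact: measurable_itv. Qed.

Lemma mleb4_qball_lty : (mleb4 (@qball R) < +oo)%E.
Proof.
apply: (@le_lt_trans _ _ (mleb4 (cube 1))); last by rewrite mleb4_cube// ltry.
apply: le_measure; rewrite ?inE; [exact: measurable_qball|exact: mcube|].
move=> q /qball_qsq; rewrite /qsq => h.
have b (x y z w : R) : x ^+ 2 + y ^+ 2 + z ^+ 2 + w ^+ 2 <= 1 -> x \in `[-1, 1].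
  by rewrite in_itv/= => ?; apply/andP; split; nra.
split; split=> /=;
  [apply: (b _ (q1 q) (q2 q) (q3 q))|apply: (b _ (q0 q) (q2 q) (q3 q))
  |apply: (b _ (q0 q) (q1 q) (q3 q))|apply: (b _ (q0 q) (q1 q) (q2 q))];
  move: h; rewrite /q0 /q1 /q2 /q3; lra.
Qed.

Lemma mleb4_qball_gt0 : (0 < mleb4 (@qball R))%E.
Proof.
have h0 : (0 : R) < 2^-1 by rewrite invr_gt0.
apply: (@lt_le_trans _ _ (mleb4 (cube 2^-1))).
  by rewrite mleb4_cube// lte_fin exprn_gt0// mulr_gt0.
apply: le_measure; rewrite ?inE; [exact: mcube|exact: measurable_qball|].
move=> q [[/= a0 a1] [/= a2 a3]]; apply/qball_qsq.
have b (x : R) : x \in `[- 2^-1, 2^-1] -> x ^+ 2 <= 4^-1.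
  by rewrite in_itv/= => /andP[? ?]; nra.
move: (b _ a0) (b _ a1) (b _ a2) (b _ a3); rewrite /qsq /q0 /q1 /q2 /q3.
by lra.
Qed.

(** Left unnormalised: its total mass V is the volume of the ball, and V^2 cancels only in the last
    step. *)
Definition sph := pushrestr _ _ _ measurable_qball measurable_qnormalize mleb4_qball_lty.

End Sphere.

Section SphereTheory.
Context {R : realType}.
Local Notation mR := (measurableTypeR R).
Local Notation Q := ((mR * mR) * (mR * mR))%type.
Local Notation sph := (@sph R).

Lemma sphE (A : set Q) : sph A = mleb4 (@qnormalize R @^-1` A `&` @qball R).
Proof. by []. Qed.

Lemma ge0_integral_sph (h : Q -> \bar R) :
  measurable_fun setT h -> (forall x, 0 <= h x)%E ->
  (\int[sph]_x h x = \int[mleb4]_(x in @qball R) h (qnormalize x))%E.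
Proof.
move=> mh h0.
exact: (ge0_integral_pushrestr mleb4 _ _ measurable_qball measurable_qnormalize h mh h0).
Qed.

Definition svol : R := fine (mleb4 (@qball R)).

Lemma svol_gt0 : 0 < svol.
Proof. by rewrite /svol fine_gt0// mleb4_qball_gt0 mleb4_qball_lty. Qed.

Lemma mleb4_qball : mleb4 (@qball R) = svol%:E.
Proof.
by rewrite fineK// ge0_fin_numE ?mleb4_qball_lty ?ltW ?mleb4_qball_gt0.
Qed.

Lemma sphT : sph setT = svol%:E.
Proof. by rewrite sphE preimage_setT setTI mleb4_qball. Qed.

(** This null hyperplane contains the origin, the only point that [qnormalize] does not send to the
    sphere. It thus also accounts for the nullity of the complement of [S3]. *)
Lemma mleb4_q0_eq0 : mleb4 [set x : Q | q0 x = 0] = 0%E.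
Proof.
rewrite (_ : [set x : Q | _] = ([set 0] `*` setT) `*` setT); last first.
  by apply/seteqP; split=> [x|x [[]]] //= ->.
have m0 : measurable ([set 0] : set mR) by exact: measurable_set1.
have m0T := measurableX m0 (@measurableT _ mR).
have /= -> := @product_measure1E _ _ _ _ R leb2 leb2 _ _ m0T (@measurableT _ _).
have /= -> := @product_measure1E _ _ _ _ R lebR lebR _ _ m0 (@measurableT _ _).
by rewrite /lebR /= lebesgue_measure_set1 !mul0e.
Qed.

Lemma measurable_q0_eq (r : R) : measurable [set x : Q | q0 x = r].
Proof.
rewrite -[X in measurable X]setTI.
exact: (measurable_q0 measurableT [set r] (measurable_set1 r)).
Qed.

Definition S3 : set Q := [set x | qsq x = 1].

Lemma measurable_S3 : measurable S3.
Proof.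
rewrite -[X in measurable X]setTI.
have m : measurable_fun setT (fun x : Q => qsq x : mR).
  exact: (measurable_qsq _ (@measurable_id _ _ _)).
exact: (m measurableT [set (1 : R)] (measurable_set1 (1 : R))).
Qed.

Lemma qnorm_sqr (u : quat R) : qnorm u ^+ 2 = qsq u.
Proof. by rewrite sqr_sqrtr// qsq_ge0. Qed.

Lemma qsq_qscale r (u : quat R) : qsq (qscale r u) = r ^+ 2 * qsq u.
Proof. by rewrite /qsq /qscale /qmk /q0 /q1 /q2 /q3 /=; ring. Qed.

Lemma qsq_eq0 (u : quat R) : qsq u = 0 -> q0 u = 0.
Proof.
move=> /eqP; rewrite /qsq -!addrA paddr_eq0 ?sqr_ge0 ?addr_ge0 ?sqr_ge0//.
by rewrite sqrf_eq0 => /andP[/eqP].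
Qed.

Lemma qsq_qnormalize (u : quat R) : q0 u != 0 -> qsq (qnormalize u) = 1.
Proof.
move=> u0; rewrite qsq_qscale exprVn qnorm_sqr mulVf//.
by apply: contra u0 => /eqP /qsq_eq0 ->.
Qed.

Lemma sph_q0_eq0 : sph [set x : Q | q0 x = 0] = 0%E.
Proof.
rewrite sphE; apply: (subset_measure0 _ _ _ mleb4_q0_eq0) => /=.
- apply: measurableI; last exact: measurable_qball.
  rewrite -[X in measurable X]setTI; apply: measurable_qnormalize => //.
  exact: measurable_q0_eq.
- exact: measurable_q0_eq.
- move=> u [/= /eqP]; rewrite (_ : q0 _ = (qnorm u)^-1 * q0 u)//.
  rewrite mulf_eq0 invr_eq0 => /orP[|/eqP//] /eqP n0 _.
  by apply: qsq_eq0; rewrite -qnorm_sqr n0 expr0n.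
Qed.

Lemma sph_S3C : sph (~` S3) = 0%E.
Proof.
have mC := measurableC measurable_S3.
rewrite sphE; apply: (subset_measure0 _ _ _ mleb4_q0_eq0) => /=.
- apply: measurableI; last exact: measurable_qball.
  by rewrite -[X in measurable X]setTI; apply: measurable_qnormalize.
- exact: measurable_q0_eq.
- move=> u [/= uS _]; have [//|/eqP u0] := pselect (q0 u = 0).
  by case: uS; exact: qsq_qnormalize.
Qed.

Lemma qnormalize_qmul (g u : quat R) : qsq g = 1 ->
  qnormalize (qmul g u) = qmul g (qnormalize u).
Proof.
move=> g1; rewrite /qnormalize.
have -> : qnorm (qmul g u) = qnorm u.
  by rewrite /qnorm -/(qsq _) qsqM g1 mul1r.
by apply: quat_eq; rewrite /qscale /qmul /qmk /q0 /q1 /q2 /q3 /=; ring.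
Qed.

Lemma measurable_qmull (g : quat R) : measurable_fun setT (qmul g : Q -> Q).
Proof.
apply: (@measurable_qmul _ _ _ (cst g) id); first exact: measurable_cst.
exact: measurable_id.
Qed.

(** Multiplication by a unit maps the ball onto itself and commutes with the radial projection, so
    Lebesgue invariance descends to the sphere. *)
Lemma mpreserving_sph (g : quat R) : qsq g = 1 -> mpreserving sph (qmul g : Q -> Q).
Proof.
move=> g1; have mg := measurable_qmull g; split=> // h mh h0.
rewrite (ge0_integral_sph _ (measurableT_comp mh mg) (fun x => h0 _)).
rewrite [RHS](ge0_integral_sph h mh h0).
have mhn : measurable_fun setT ((h \o @qnormalize R) \_ (@qball R)).
  apply/(measurable_restrictT _ measurable_qball); apply: measurable_funTS.
  exact: (measurableT_comp mh measurable_qnormalize).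
rewrite integral_mkcond [RHS]integral_mkcond.
have [_ inv] := mpreserving_qmul _ g1.
have hn0 u : (0 <= ((h \o @qnormalize R) \_ (@qball R)) u)%E.
  by rewrite /patch; case: ifP => // _; exact: h0.
rewrite -[RHS](inv _ mhn hn0).
apply: eq_integral => u _; rewrite /patch /= qnormalize_qmul//.
congr (if _ then _ else _); apply/idP/idP => /set_mem/qball_qsq h1;
  by apply/mem_set/qball_qsq; move: h1; rewrite qsqM g1 mul1r.
Qed.

End SphereTheory.

(** * Chebyshev polynomials *)

(** The difference vanishes at 0, 1, ..., size (p - q), which are distinct and more numerous than
    its degree allows. *)
Lemma poly_eq_horner (R : realFieldType) (p q : {poly R}) :
  (forall x, p.[x] = q.[x]) -> p = q.
Proof.
move=> pq; apply/eqP; rewrite -subr_eq0; apply/eqP.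
pose s := [seq i%:R | i <- iota 0 (size (p - q)).+1] : seq R.
apply: (@roots_geq_poly_eq0 _ _ s).
- by apply/allP => x _; rewrite /root hornerD hornerN pq subrr.
- by rewrite map_inj_uniq ?iota_uniq// => i j /eqP; rewrite eqr_nat => /eqP.
- by rewrite size_map size_iota.
Qed.

Lemma coef_1DX2n (R : comNzRingType) m :
  let p : {poly R} := (1 + 'X^2) ^+ m in p`_0 = 1 /\ p`_2 = m%:R.
Proof.
elim: m => [|m [IH0 IH2]] /=; first by rewrite expr0 !coef1.
rewrite exprSr mulrDr mulr1 !coefD !coefMXn /= IH0 IH2 addr0.
by rewrite -natr1.
Qed.

Section Chebyshev.
Context {R : realFieldType}.

(* The pair (T_n, U_(n-1)) of Chebyshev polynomials, that is
   (cos (n t), sin (n t) / sin t) as polynomials in cos t. *)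
Fixpoint cheb (n : nat) : {poly R} * {poly R} :=
  if n is n'.+1 then
    let: (T, W) := cheb n' in ('X * T - (1 - 'X^2) * W, T + 'X * W)
  else (1, 0).

Definition chebT n := (cheb n).1.
Definition chebW n := (cheb n).2.

Lemma chebTS n : chebT n.+1 = 'X * chebT n - (1 - 'X^2) * chebW n.
Proof. by rewrite /chebT /chebW /=; case: cheb. Qed.

Lemma chebWS n : chebW n.+1 = chebT n + 'X * chebW n.
Proof. by rewrite /chebT /chebW /=; case: cheb. Qed.

Lemma chebT0 : chebT 0 = 1. Proof. by []. Qed.
Lemma chebW0 : chebW 0 = 0. Proof. by []. Qed.

Lemma chebT1 : chebT 1 = 'X.
Proof. by rewrite chebTS chebT0 chebW0; ring. Qed.

Lemma chebTSS n : chebT n.+2 = 2 * 'X * chebT n.+1 - chebT n.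
Proof. by rewrite chebTS chebWS chebTS; ring. Qed.

(** This is cos^2 + sin^2 = 1 at the angle n t. It gives |T_n| <= 1 on [-1, 1] without trigonometric
    functions. *)
Lemma cheb_pythagoras n : chebT n ^+ 2 + (1 - 'X^2) * chebW n ^+ 2 = 1.
Proof.
elim: n => [|n IH]; first by rewrite chebT0 chebW0; ring.
by rewrite -[RHS]IH chebTS chebWS; ring.
Qed.

Lemma chebT_bound n (x : R) : `|x| <= 1 -> `|(chebT n).[x]| <= 1.
Proof.
move=> x1; have := congr1 (horner^~ x) (cheb_pythagoras n).
rewrite /= -polyC1 !(hornerD, hornerM, hornerN, horner_exp, hornerX, hornerC) => h.
rewrite -[leRHS]normr1 -ler_sqr ?nnegrE// !real_normK ?num_real//.
have x2 : x ^+ 2 <= 1.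
  by rewrite -[leRHS](expr1n _ 2) -real_normK ?num_real// ler_sqr ?nnegrE.
have : 0 <= (1 - x ^+ 2) * (chebW n).[x] ^+ 2 by rewrite mulr_ge0 ?sqr_ge0 ?subr_ge0.
move=> h2; by rewrite expr1n -[leRHS]h lerDl.
Qed.

(** Differentiation of cos (n t) and sin (n t) / sin t with respect to cos t. The two identities
    need each other in the induction, and the factor 1 - X^2 keeps the second one polynomial. *)
Lemma deriv_cheb n : (chebT n)^`() = n%:R * chebW n /\
  (1 - 'X^2) * (chebW n)^`() = 'X * chebW n - n%:R * chebT n.
Proof.
elim: n => [|n [IHT IHW]].
  by rewrite chebT0 chebW0 -[1]/(1%:P) derivC deriv0; split; ring.
have dX2 : (1 - 'X^2 : {poly R})^`() = - (2 * 'X).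
  by rewrite derivB -[1]/(1%:P) derivC derivXn /= sub0r -mulr_natl.
split.
  rewrite chebTS derivB !derivM derivX dX2 IHW IHT chebWS -natr1; ring.
rewrite chebWS derivD derivM derivX mulrDr mulrDr.
rewrite [(1 - _) * ('X * _)]mulrCA IHW IHT chebTS -natr1; ring.
Qed.

(* In terms of u = cos t this is d(T_(n+1)(cos t) (sin t)^3) divided by
   (sin t)^2: the differential operator kills the semicircle law. *)
Lemma chebT_operator n :
  (1 - 'X^2) * (chebT n.+1)^`() - 3 * 'X * chebT n.+1 =
  2^-1 *: ((n%:R - 2) * chebT n - (n%:R + 4) * chebT n.+2).
Proof.
have [-> _] := deriv_cheb n.+1.
have -> : (n%:R - 2) * chebT n - (n%:R + 4) * chebT n.+2 =
    2 * ((1 - 'X^2) * (n.+1%:R * chebW n.+1) - 3 * 'X * chebT n.+1).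
  by rewrite chebTSS chebTS chebWS -natr1; ring.
set L := _ - _.
by rewrite (mulr_natl L 2) -(scaler_nat 2 L) scalerA mulVf ?pnatr_eq0// scale1r.
Qed.

End Chebyshev.

(** * Moments of an invariant measure *)

Section InvariantMean.
Context {R : realType}.
Local Notation mR := (measurableTypeR R).
Local Notation Q := ((mR * mR) * (mR * mR))%type.
Local Notation S3 := (@S3 R).
Variable s : FiniteMeasure.type Q R.
Hypothesis s_inv : forall g : quat R, qsq g = 1 -> mpreserving s (qmul g : Q -> Q).
Hypothesis sS3C : s (~` S3) = 0%E.
Local Notation V := (fine (s setT)).

Lemma ge0_integral_S3 (h : Q -> \bar R) : measurable_fun setT h ->
  (forall x, 0 <= h x)%E -> (\int[s]_(x in S3) h x = \int[s]_x h x)%E.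
Proof.
move=> mh h0.
rewrite [RHS](ge0_negligible_integral (measurableC measurable_S3) measurableT
  mh (fun x _ => h0 x) sS3C).
by rewrite setTD setCK.
Qed.

Lemma S3_qmul (g x : quat R) : qsq g = 1 -> S3 (qmul g x) <-> S3 x.
Proof. by move=> g1; rewrite /S3 /= qsqM g1 mul1r. Qed.

Lemma ge0_integral_S3_qmul (h : Q -> \bar R) (g : quat R) : qsq g = 1 ->
  measurable_fun setT h -> (forall x, S3 x -> 0 <= h x)%E ->
  (\int[s]_(x in S3) h (qmul g x) = \int[s]_(x in S3) h x)%E.
Proof.
move=> g1 mh h0; have [_ inv] := s_inv _ g1.
have mhS : measurable_fun setT (h \_ S3).
  apply/(measurable_restrictT _ measurable_S3); exact: measurable_funTS.
rewrite integral_mkcond [RHS]integral_mkcond -[RHS](inv _ mhS); last first.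
  by move=> x; rewrite /patch; case: ifP => // /set_mem; exact: h0.
apply: eq_integral => x _; rewrite /patch.
congr (if _ then _ else _); apply/idP/idP => /set_mem h1;
  by apply/mem_set; move: h1; rewrite S3_qmul.
Qed.

Lemma s_S3 : s S3 = s setT.
Proof.
have := ge0_integral_S3 (cst 1%E) (measurable_cst _) (fun _ => lee01).
by rewrite !integral_cst//= ?mul1e//; exact: measurable_S3.
Qed.

(** A class closed under polynomial operations and integrable on [S3]. The bound is asked on the
    sphere only, since coordinates are unbounded elsewhere. *)
Definition bdd_mfun (f : quat R -> R) : Prop :=
  measurable_fun setT (f : Q -> mR) /\ exists M, forall x, S3 x -> `|f x| <= M.

Lemma bdd_mfun_cst k : bdd_mfun (fun=> k).
Proof. by split; [exact: measurable_cst|exists `|k|]. Qed.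

Lemma bdd_mfunD f g : bdd_mfun f -> bdd_mfun g -> bdd_mfun (fun x => f x + g x).
Proof.
move=> [mf [M fM]] [mg [N gN]]; split; first exact: measurable_funD.
by exists (M + N) => x Sx; rewrite (le_trans (ler_normD _ _))// lerD ?fM ?gN.
Qed.

Lemma bdd_mfunM f g : bdd_mfun f -> bdd_mfun g -> bdd_mfun (fun x => f x * g x).
Proof.
move=> [mf [M fM]] [mg [N gN]]; split; first exact: measurable_funM.
by exists (M * N) => x Sx; rewrite normrM ler_pM ?fM ?gN.
Qed.

Lemma bdd_mfunZ k f : bdd_mfun f -> bdd_mfun (fun x => k * f x).
Proof. by move=> bf; apply: bdd_mfunM => //; exact: bdd_mfun_cst. Qed.

Lemma bdd_mfunB f g : bdd_mfun f -> bdd_mfun g -> bdd_mfun (fun x => f x - g x).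
Proof.
move=> bf bg; rewrite (_ : (fun _ => _) = (fun x => f x + (-1) * g x)).
  by apply: bdd_mfunD => //; exact: bdd_mfunZ.
by apply/funext => x; rewrite mulN1r.
Qed.

Lemma bdd_mfunX f n : bdd_mfun f -> bdd_mfun (fun x => f x ^+ n).
Proof.
move=> bf; elim: n => [|n IH].
  by rewrite (_ : (fun _ => _) = (fun=> 1));
    [exact: bdd_mfun_cst|apply/funext => x; rewrite expr0].
rewrite (_ : (fun _ => _) = (fun x => f x * f x ^+ n)); first exact: bdd_mfunM.
by apply/funext => x; rewrite exprS.
Qed.

Lemma bdd_mfun_sum (I : Type) (r : seq I) (F : I -> quat R -> R) :
  (forall i, bdd_mfun (F i)) -> bdd_mfun (fun x => \sum_(i <- r) F i x).
Proof.
move=> bF; elim: r => [|i r IH].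
  by rewrite (_ : (fun _ => _) = (fun=> 0));
    [exact: bdd_mfun_cst|apply/funext => x; rewrite big_nil].
rewrite (_ : (fun _ => _) = (fun x => F i x + \sum_(j <- r) F j x)); first exact: bdd_mfunD.
by apply/funext => x; rewrite big_cons.
Qed.

Lemma S3_coord (x : quat R) : S3 x ->
  [/\ `|q0 x| <= 1, `|q1 x| <= 1, `|q2 x| <= 1 & `|q3 x| <= 1].
Proof.
rewrite /S3 /= /qsq => x1.
have h (t : R) : t ^+ 2 <= 1 -> `|t| <= 1.
  by move=> t1; rewrite -ler_sqr ?nnegrE// expr1n real_normK ?num_real.
have := (sqr_ge0 (q0 x), sqr_ge0 (q1 x), sqr_ge0 (q2 x), sqr_ge0 (q3 x)).
by move=> [[[? ?] ?] ?]; split; apply: h; lra.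
Qed.

Lemma bdd_mfun_q0 : bdd_mfun (@q0 R).
Proof. by split; [exact: measurable_q0|exists 1 => x /S3_coord[]]. Qed.
Lemma bdd_mfun_q1 : bdd_mfun (@q1 R).
Proof. by split; [exact: measurable_q1|exists 1 => x /S3_coord[]]. Qed.
Lemma bdd_mfun_q2 : bdd_mfun (@q2 R).
Proof. by split; [exact: measurable_q2|exists 1 => x /S3_coord[]]. Qed.
Lemma bdd_mfun_q3 : bdd_mfun (@q3 R).
Proof. by split; [exact: measurable_q3|exists 1 => x /S3_coord[]]. Qed.

Lemma bdd_mfun_integrable f : bdd_mfun f -> s.-integrable S3 (EFin \o f).
Proof.
move=> [mf [M fM]]; apply: measurable_bounded_integrable.
- exact: measurable_S3.
- by rewrite -ge0_fin_numE// fin_num_measure//; exact: measurable_S3.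
- exact: measurable_funTS.
- exists M; split; first exact: num_real.
  by move=> N MN x Sx /=; apply: (le_trans (fM _ Sx)); exact: ltW.
Qed.

(** Expectation up to normalisation: the constant 1 has value V. *)
Definition Ex (f : quat R -> R) : R := \int[s]_(x in S3) f x.

Lemma Ex_eq f g : (forall x, S3 x -> f x = g x) -> Ex f = Ex g.
Proof. by move=> fg; apply: eq_Rintegral => x /set_mem; exact: fg. Qed.

Lemma ExD f g : bdd_mfun f -> bdd_mfun g -> Ex (fun x => f x + g x) = Ex f + Ex g.
Proof.
move=> bf bg; apply: RintegralD; first exact: measurable_S3.
  exact: bdd_mfun_integrable.
exact: bdd_mfun_integrable.
Qed.

Lemma ExZ k f : bdd_mfun f -> Ex (fun x => k * f x) = k * Ex f.
Proof.
move=> bf; apply: RintegralZl; first exact: measurable_S3.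
exact: bdd_mfun_integrable.
Qed.

Lemma ExB f g : bdd_mfun f -> bdd_mfun g -> Ex (fun x => f x - g x) = Ex f - Ex g.
Proof.
move=> bf bg; apply: RintegralB; first exact: measurable_S3.
  exact: bdd_mfun_integrable.
exact: bdd_mfun_integrable.
Qed.

Lemma Ex_cst k : Ex (fun=> k) = k * V.
Proof.
by rewrite /Ex (Rintegral_cst s measurable_S3); congr (_ * fine _); exact: s_S3.
Qed.

Lemma Ex_sum (I : Type) (r : seq I) (F : I -> quat R -> R) :
  (forall i, bdd_mfun (F i)) -> Ex (fun x => \sum_(i <- r) F i x) = \sum_(i <- r) Ex (F i).
Proof.
move=> bF; elim: r => [|i r IH].
  rewrite big_nil -[RHS](mul0r V) -(Ex_cst 0).
  by apply: Ex_eq => x _; rewrite big_nil.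
rewrite big_cons -IH -ExD//; last exact: bdd_mfun_sum.
by apply: Ex_eq => x _; rewrite big_cons.
Qed.

Lemma Ex_le_bound f M : bdd_mfun f -> (forall x, S3 x -> `|f x| <= M) -> `|Ex f| <= M * V.
Proof.
move=> bf fM; have le1 := le_normr_Rintegral measurable_S3 (bdd_mfun_integrable f bf).
apply: (le_trans le1).
rewrite -Ex_cst; apply: le_Rintegral.
- exact: measurable_S3.
- by apply: integrable_norm; exact: bdd_mfun_integrable.
- by apply: bdd_mfun_integrable; exact: bdd_mfun_cst.
- exact: fM.
Qed.

(** Invariance is known for nonnegative functions, so the bound M of f is added first and its
    integral cancelled afterwards. *)
Lemma Ex_qmul g f : qsq g = 1 -> bdd_mfun f -> Ex (fun x => f (qmul g x)) = Ex f.
Proof.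
move=> g1 bf; have [mf [M fM]] := bf.
have bfM := bdd_mfunD _ _ bf (bdd_mfun_cst M).
have mfg : measurable_fun setT (fun x : Q => f (qmul g x) : mR).
  by have := measurableT_comp mf (measurable_qmull g).
have bfg : bdd_mfun (fun x => f (qmul g x)).
  by split => //; exists M => x Sx; apply: fM; rewrite S3_qmul.
apply: (addIr (Ex (fun=> M))); rewrite -!ExD//; try exact: bdd_mfun_cst.
congr fine; apply: (ge0_integral_S3_qmul (fun x => (f x + M)%:E)) => //.
  by apply/measurable_EFinP; case: bfM.
move=> x Sx; rewrite lee_fin -lerBlDr sub0r.
by have := fM _ Sx; rewrite ler_norml => /andP[].
Qed.

End InvariantMean.

Section Moments.
Context {R : realType}.
Local Notation mR := (measurableTypeR R).
Local Notation Q := ((mR * mR) * (mR * mR))%type.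
Local Notation S3 := (@S3 R).
Variable s : FiniteMeasure.type Q R.
Hypothesis s_inv : forall g : quat R, qsq g = 1 -> mpreserving s (qmul g : Q -> Q).
Hypothesis sS3C : s (~` S3) = 0%E.
Local Notation V := (fine (s setT)).
Local Notation Ex := (Ex s).
Local Notation mom n := (Ex (fun x => q0 x ^+ n)).

(** Write g = r h with h a unit: r comes out and h is absorbed by invariance. The even exponent
    turns r^(2n) into a power of [qsq g], hence a polynomial in the coordinates of g. *)
Lemma Ex_q0_qmul (g : quat R) n :
  Ex (fun x => q0 (qmul g x) ^+ (n.*2)) = qsq g ^+ n * mom n.*2.
Proof.
have [g0|g0] := eqVneq (qsq g) 0.
  have g00 : g = qmk 0 0 0 0.
    move: g0; rewrite /qsq => g0.
    have := (sqr_ge0 (q0 g), sqr_ge0 (q1 g), sqr_ge0 (q2 g), sqr_ge0 (q3 g)).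
    move=> [[[h0 h1] h2] h3].
    apply: quat_eq; apply/eqP; rewrite -sqrf_eq0 /q0 /q1 /q2 /q3 /=; apply/eqP;
      by move: g0 h0 h1 h2 h3; rewrite /q0 /q1 /q2 /q3; lra.
  have -> : (fun x => q0 (qmul g x) ^+ n.*2) = (fun=> 0 ^+ n.*2).
    by apply/funext => x; congr (_ ^+ _); rewrite g00 /qmul /qmk /q0 /q1 /q2 /q3 /=; ring.
  (* For g = 0 and n = 0 both sides are V, because 0 ^+ 0 is 1. *)
  rewrite (Ex_cst s sS3C) g0; case: n => [|n]; last by rewrite doubleS !exprS !mul0r.
  rewrite double0 !expr0; congr (_ * _); rewrite -[LHS]mul1r -(Ex_cst s sS3C 1).
  by apply: Ex_eq => x _; rewrite expr0.
have gp : 0 < qsq g by rewrite lt_neqAle eq_sym g0 qsq_ge0.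
pose r := sqrtr (qsq g); have r2 : r ^+ 2 = qsq g by rewrite sqr_sqrtr// ltW.
have rn0 : r != 0 by rewrite -sqrf_eq0 r2.
pose h := qscale r^-1 g.
have h1 : qsq h = 1 by rewrite qsq_qscale exprVn r2 mulVf.
have bq : bdd_mfun (fun x => @q0 R x ^+ n.*2) by apply: bdd_mfunX; exact: bdd_mfun_q0.
rewrite -(Ex_qmul s s_inv _ _ h1 bq).
rewrite -r2 -exprM mul2n -ExZ; last first.
  split; last first.
    by have [_ [M bM]] := bq; exists M => x Sx; apply: bM; rewrite (S3_qmul _ _ h1).
  have [mq _] := bq; exact: (measurableT_comp mq (measurable_qmull h)).
apply: Ex_eq => x _; rewrite -exprMn; congr (_ ^+ _).
rewrite /h /qscale /qmul /qmk /q0 /q1 /q2 /q3 /=; by field; exact: rn0.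
Qed.

(** The antipodal map is multiplication by the unit -1 and changes the sign of an odd power. *)
Lemma mom_odd n : mom n.*2.+1 = 0.
Proof.
have m1 : qsq (qmk (-1) 0 0 0 : quat R) = 1.
  by rewrite /qsq /qmk /q0 /q1 /q2 /q3 /=; ring.
have bq : bdd_mfun (fun x => @q0 R x ^+ n.*2.+1) by apply: bdd_mfunX; exact: bdd_mfun_q0.
have := Ex_qmul s s_inv _ _ m1 bq.
have -> : Ex (fun x => q0 (qmul (qmk (-1) 0 0 0) x) ^+ n.*2.+1) = -1 * mom n.*2.+1.
  rewrite -ExZ//; apply: Ex_eq => x _.
  have -> : q0 (qmul (qmk (-1) 0 0 0) x) = - q0 x.
    by rewrite /qmul /qmk /q0 /q1 /q2 /q3 /=; ring.
  by rewrite -[- q0 x]mulN1r exprMn -signr_odd /= odd_double expr1.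
by move=> h; lra.
Qed.

(* By invariance E (q0 + t qj)^(2n+2) = (1 + t^2)^(n+1) E q0^(2n+2) for all t;
   compare the coefficients of t^2. *)
Let second_moment (qj : quat R -> R) n : bdd_mfun qj ->
  (forall t, exists2 g, qsq g = 1 + t ^+ 2 & forall x, q0 (qmul g x) = q0 x + t * qj x) ->
  (n.*2.+1)%:R * Ex (fun x => q0 x ^+ n.*2 * qj x ^+ 2) = mom n.*2.+2.
Proof.
move=> bj hj; pose m := n.+1; pose e i := Ex (fun x => q0 x ^+ (m.*2 - i) * qj x ^+ i).
have be i : bdd_mfun (fun x => @q0 R x ^+ (m.*2 - i) * qj x ^+ i).
  by apply: bdd_mfunM; apply: bdd_mfunX => //; exact: bdd_mfun_q0.
pose P := \poly_(i < m.*2.+1) ('C(m.*2, i)%:R * e i) : {poly R}.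
pose P' := (mom m.*2)%:P * (1 + 'X^2) ^+ m : {poly R}.
have PP' : P = P'.
  apply: poly_eq_horner => t.
  rewrite /P' hornerM hornerC horner_exp hornerD hornerXn -polyC1 hornerC mulrC.
  have [g gt gx] := hj t.
  rewrite -gt -Ex_q0_qmul horner_poly.
  rewrite (Ex_eq s _ (fun x => \sum_(i < m.*2.+1)
     (('C(m.*2, i))%:R * t ^+ i) * (q0 x ^+ (m.*2 - i) * qj x ^+ i))); last first.
    move=> x _; rewrite gx exprDn; apply: eq_bigr => i _.
    by rewrite exprMn -mulr_natl; ring.
  rewrite Ex_sum//; last by move=> i; exact: bdd_mfunZ.
  by apply: eq_bigr => i _; rewrite ExZ// -/(e i); ring.
have := congr1 (fun p : {poly R} => p`_2) PP'.
rewrite /P /P' coef_poly /= coefCM.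
have [_ ->] := @coef_1DX2n R m.
(* The coefficients of t^2 are C(2m, 2) E(q0^(2n) qj^2) and m E q0^(2m), with m = n + 1. Since C(2m,
   2) = (n + 1)(2n + 1), the factor n + 1 cancels. *)
rewrite {1}/m doubleS /= /e /m doubleS subn2 /= bin2 /= => h.
have n0 : (n.+1%:R : R) != 0 by rewrite pnatr_eq0.
apply: (mulfI n0); rewrite mulrA -natrM.
have -> : (n.+1 * n.*2.+1 = ((n.*2.+2 * n.*2.+1)./2))%N.
  by rewrite -doubleS -doubleMl doubleK.
by rewrite [RHS]mulrC -h.
Qed.

(** Insert 1 = q0^2 + q1^2 + q2^2 + q3^2 into E q0^(2n). Each of the three mixed moments is E
    q0^(2n+2) / (2n + 1), and (2n + 1) + 3 = 2n + 4. *)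
Lemma mom_even n : (n.*2.+4)%:R * mom n.*2.+2 = (n.*2.+1)%:R * mom n.*2.
Proof.
have b0 k : bdd_mfun (fun x => @q0 R x ^+ k) by apply: bdd_mfunX; exact: bdd_mfun_q0.
have bj (qj : quat R -> R) : bdd_mfun qj -> bdd_mfun (fun x => q0 x ^+ n.*2 * qj x ^+ 2).
  by move=> b; apply: bdd_mfunM => //; exact: bdd_mfunX.
have h1 t : exists2 g, qsq g = 1 + t ^+ 2 &
    forall x, q0 (qmul g x) = q0 x + t * @q1 R x.
  (* The multiplier is 1 - t i; the sign compensates i^2 = -1. *)
  exists (qmk 1 (- t) 0 0) => [|x];
  by rewrite /qsq /qmul /qmk /q0 /q1 /q2 /q3 /=; ring.
have h2 t : exists2 g, qsq g = 1 + t ^+ 2 &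
    forall x, q0 (qmul g x) = q0 x + t * @q2 R x.
  exists (qmk 1 0 (- t) 0) => [|x];
  by rewrite /qsq /qmul /qmk /q0 /q1 /q2 /q3 /=; ring.
have h3 t : exists2 g, qsq g = 1 + t ^+ 2 &
    forall x, q0 (qmul g x) = q0 x + t * @q3 R x.
  exists (qmk 1 0 0 (- t)) => [|x];
  by rewrite /qsq /qmul /qmk /q0 /q1 /q2 /q3 /=; ring.
have e1 := second_moment _ n bdd_mfun_q1 h1; have e2 := second_moment _ n bdd_mfun_q2 h2.
have e3 := second_moment _ n bdd_mfun_q3 h3.
have : mom n.*2 = mom n.*2.+2 + Ex (fun x => q0 x ^+ n.*2 * q1 x ^+ 2)
  + Ex (fun x => q0 x ^+ n.*2 * q2 x ^+ 2) + Ex (fun x => q0 x ^+ n.*2 * q3 x ^+ 2).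
  have [[B1 B2] B3] := (bj _ bdd_mfun_q1, bj _ bdd_mfun_q2, bj _ bdd_mfun_q3).
  rewrite -(ExD s _ _ (b0 _) B1) -(ExD s _ _ (bdd_mfunD _ _ (b0 _) B1) B2).
  rewrite -(ExD s _ _ (bdd_mfunD _ _ (bdd_mfunD _ _ (b0 _) B1) B2) B3).
  apply: Ex_eq => x; rewrite /S3 /= /qsq => x1.
  have -> : q0 x ^+ n.*2.+2 = q0 x ^+ n.*2 * q0 x ^+ 2 by rewrite -exprD addn2.
  rewrite -[LHS]mulr1 -x1; ring.
move=> ->; rewrite !mulrDr e1 e2 e3 -!natr1; ring.
Qed.

Lemma bdd_mfun_horner (q : {poly R}) : bdd_mfun (fun x => q.[@q0 R x]).
Proof.
rewrite (_ : (fun _ => _) = fun x => \sum_(i < size q) q`_i * q0 x ^+ i).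
  by apply: bdd_mfun_sum => i; apply: bdd_mfunZ; apply: bdd_mfunX; exact: bdd_mfun_q0.
by apply/funext => x; rewrite horner_coef.
Qed.

(** By linearity p may be a monomial. The operator sends X^(k+1) to (k + 1) X^k - (k + 4) X^(k+2),
    whose mean vanishes by parity for odd k and by [mom_even] for even k; it sends 1 to -3 X. *)
Lemma Ex_poly_operator (p : {poly R}) :
  Ex (fun x => ((1 - 'X^2) * p^`() - 3 * 'X * p).[q0 x]) = 0.
Proof.
pose L (q : {poly R}) := Ex (fun x => q.[q0 x]).
pose D (q : {poly R}) := (1 - 'X^2) * q^`() - 3 * 'X * q.
have LD p1 p2 : L (p1 + p2) = L p1 + L p2.
  by rewrite /L -ExD; try exact: bdd_mfun_horner; apply: Ex_eq => x _; rewrite hornerD.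
have LZ k p1 : L (k *: p1) = k * L p1.
  by rewrite /L -ExZ; try exact: bdd_mfun_horner; apply: Ex_eq => x _; rewrite hornerZ.
have LX n : L 'X^n = mom n.
  by apply: Ex_eq => x _; rewrite hornerXn.
have DD p1 p2 : D (p1 + p2) = D p1 + D p2 by rewrite /D derivD; ring.
have DZ k p1 : D (k *: p1) = k *: D p1.
  by rewrite /D derivZ -!mul_polyC; ring.
have L0 : L 0 = 0 by rewrite -(scale0r 0) LZ mul0r.
have D0 : D 0 = 0 by rewrite /D deriv0; ring.
rewrite -/(L _) -/(D p) -[p]coefK poly_def.
elim/big_ind: _ => [|p1 p2 e1 e2|i _]; first by rewrite D0.
  by rewrite DD (LD (D p1) (D p2)) e1 e2 addr0.
rewrite DZ (LZ _ (D _)); apply/eqP; rewrite mulf_eq0; apply/orP; right; apply/eqP.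
case: (i : nat) => [|k] {i}.
  have -> : D 'X^0 = (- 3 : R) *: 'X^1 by
    rewrite /D expr0 -polyC1 derivC -mul_polyC polyCN; ring.
  by rewrite LZ LX (mom_odd 0) mulr0.
have -> : D 'X^(k.+1) = (k.+1%:R : R) *: 'X^k + (- k.+4%:R : R) *: 'X^(k.+2).
  rewrite /D derivXn /= -mulr_natl -!mul_polyC polyCN !rmorph_nat !exprS -!natr1 /=; ring.
rewrite LD !LZ !LX.
have [ok|ek] := boolP (odd k).
  have -> : k = k./2.*2.+1 by rewrite -[LHS](odd_double_half k) ok.
  by rewrite -doubleS !mom_odd; ring.
have -> : k = k./2.*2 by rewrite -[LHS](odd_double_half k) (negbTE ek).
by rewrite mulNr mom_even subrr.
Qed.

Local Notation ET n := (Ex (fun x => (chebT n).[q0 x])).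

Let ET_rec n : (n%:R - 2) * ET n = (n%:R + 4) * ET n.+2.
Proof.
have := Ex_poly_operator (chebT n.+1); rewrite chebT_operator => h.
apply/eqP; rewrite -subr_eq0; apply/eqP.
rewrite -[RHS](mulr0 2) -h -!ExZ; try exact: bdd_mfun_horner.
rewrite -ExB; try by apply: bdd_mfunZ; exact: bdd_mfun_horner.
apply: Ex_eq => x _.
rewrite hornerZ mulrA mulfV ?pnatr_eq0// mul1r !(hornerD, hornerN, hornerM).
by rewrite -!polyC_natr !hornerC.
Qed.

Lemma Ex_chebT1 : ET 1 = 0.
Proof.
by rewrite -(mom_odd 0); apply: Ex_eq => x _; rewrite chebT1 hornerX expr1.
Qed.

Lemma Ex_chebT2 : ET 2 = - (V / 2).
Proof.
have : ET 0 = V.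
  by rewrite -[RHS]mul1r -(Ex_cst s sS3C); apply: Ex_eq => x _; rewrite chebT0 hornerC.
by have := ET_rec 0; lra.
Qed.

(** The recursion advances by two. Its factor n - 2 vanishes at n = 2, which kills E T_4 although E
    T_2 is not 0; the odd chain starts from E T_1 = 0. *)
Lemma Ex_chebT n : ET n.+3 = 0.
Proof.
have step k : (k%:R - 2) * ET k = 0 -> ET k.+2 = 0.
  rewrite ET_rec => /eqP; rewrite mulf_eq0 => /orP[|/eqP//].
  by rewrite -natrD pnatr_eq0 addn4.
suff : ET n.+3 = 0 /\ ET n.+4 = 0 by case.
elim: n => [|n [IH1 IH2]]; split=> //.
- by apply: step; rewrite Ex_chebT1 mulr0.
- by apply: step; rewrite subrr mul0r.
- by apply: step; rewrite IH1 mulr0.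
Qed.

End Moments.

(** * Logarithmic mean on the sphere *)

Section LogSeries.
Context {R : realType}.
Implicit Types (t r : R) (N : nat).

(* Partial sum of the expansion of ln |1 + r e^(i u)|^2 in cos (n u). *)
Definition logT N t r : R :=
  \sum_(n < N) - (2 * (- r) ^+ n.+1 / n.+1%:R) * (chebT n.+1).[t].

Let dlogT N t r : R := \sum_(n < N) 2 * (- r) ^+ n * (chebT n.+1).[t].

Let is_derive_logT N t r : is_derive r 1 (logT N t) (dlogT N t r).
Proof.
pose P : {poly R} := \sum_(n < N)
  (- (2 * (-1) ^+ n.+1 / n.+1%:R) * (chebT n.+1).[t]) *: 'X^(n.+1).
have -> : logT N t = horner P.
  apply/funext => x; rewrite /logT /P horner_sum; apply: eq_bigr => n _.
  by rewrite hornerZ hornerXn [(- x) ^+ _]exprNn; ring.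
have -> : dlogT N t r = P^`().[r].
  rewrite /dlogT /P raddf_sum horner_sum; apply: eq_bigr => n _.
  rewrite /= derivZ derivXn /= hornerZ hornerMn hornerXn -[r ^+ _ *+ _]mulr_natr.
  rewrite [(- r) ^+ _]exprNn exprS.
  have : (n.+1%:R : R) != 0 by rewrite pnatr_eq0.
  by move: (n.+1%:R : R) => m m0; field.
exact: is_derive_poly.
Qed.

Let den t r : R := 1 + 2 * r * t + r ^+ 2.

Let den_ge t r : `|t| <= 1 -> 0 <= r -> (1 - r) ^+ 2 <= den t r.
Proof.
by rewrite ler_norml => /andP[t1 t2] r0; rewrite /den; nra.
Qed.

Let horner_chebTSS t n :
  (chebT n.+2).[t] = 2 * t * (chebT n.+1).[t] - (chebT n).[t].
Proof.
by rewrite chebTSS -polyC_natr !(hornerD, hornerN, hornerM) hornerX hornerC.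
Qed.

(** The three-term recurrence makes the product telescope. What remains is the r-derivative 2 (t +
    r) of [den] and an error of order r^N. *)
Let dlogT_den N t r : den t r * dlogT N t r =
  2 * (t + r) - 2 * (- r) ^+ N * ((chebT N.+1).[t] + r * (chebT N).[t]).
Proof.
elim: N => [|N IH].
  by rewrite /dlogT big_ord0 chebT1 chebT0 hornerX -polyC1 hornerC expr0; ring.
rewrite /dlogT big_ord_recr /= mulrDr -/(dlogT N t r) IH horner_chebTSS /den [(- r) ^+ N.+1]exprS.
ring.
Qed.

(** The difference vanishes at r = 0, and its derivative at c is 2 (-c)^N (T_(N+1) + c T_N) / [den],
    at most 4 r^N / (1 - r)^2 in absolute value; the mean value theorem concludes. The bound is
    uniform in t, so it can be integrated. The case N = 0 bounds the logarithm itself. *)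
Lemma logT_approx N t r : `|t| <= 1 -> 0 <= r < 1 ->
  `|ln (1 + 2 * r * t + r ^+ 2) - logT N t r| <= 4 * r ^+ N / (1 - r) ^+ 2.
Proof.
move=> t1 /andP[r0 r1].
have den_gt0 c : 0 <= c <= r -> 0 < den t c.
  move=> /andP[c0 cr]; apply: lt_le_trans (den_ge _ _ t1 c0).
  by rewrite exprn_gt0// subr_gt0 (le_lt_trans cr).
pose f c := ln (den t c) - logT N t c.
pose df c := (2 * t + 2 * c) / den t c - dlogT N t c.
have is_derive_f c : 0 <= c <= r -> is_derive c 1 f (df c).
  move=> cr; have d0 := den_gt0 _ cr.
  pose D : {poly R} := 1%:P + (2 * t) *: 'X + 'X^2.
  have DE x : den t x = D.[x].
    by rewrite /D !hornerD hornerC hornerZ hornerX hornerXn /den; ring.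
  have dD : D^`().[c] = 2 * t + 2 * c.
    rewrite /D !derivD derivC derivZ derivX derivXn /= !hornerD hornerC hornerZ.
    by rewrite -polyC1 !hornerC !hornerX; ring.
  have h1 := is_derive_poly D c.
  have h2 : is_derive D.[c] 1 (@ln R) (D.[c])^-1 by apply: is_derive1_ln; rewrite -DE.
  have := is_derive1_comp h2 h1 => h3.
  have -> : f = (@ln R \o horner D) - logT N t.
    by apply/funext => x; rewrite /f DE.
  apply: is_deriveB; last exact: is_derive_logT.
  by apply: is_derive_eq h3 _; rewrite dD DE mulrC.
have is_derive_oo x : x \in `]0, r[ -> is_derive x 1 f (df x).
  by rewrite in_itv => /andP[x0 xr]; apply: is_derive_f; rewrite !ltW.
have cont_f : {within `[0, r], continuous f}.
  apply: derivable_within_continuous => x; rewrite in_itv => xr.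
  by have [] := is_derive_f _ xr.
have [c] := MVT_segment r0 is_derive_oo cont_f.
rewrite in_itv => cr.
have f0 : f 0 = 0.
  rewrite /f /den mulr0 mul0r addr0 expr0n addr0 ln1 sub0r.
  rewrite /logT big1 ?oppr0// => i _.
  by rewrite expr0n /= mulr0 mul0r oppr0 mul0r.
rewrite f0 !subr0 -/(den t r) -/(f r) => ->.
have d0 := den_gt0 _ cr; have [c0 cr'] := andP cr.
have -> : df c = 2 * (- c) ^+ N * ((chebT N.+1).[t] + c * (chebT N).[t]) / den t c.
  apply: (mulIf (lt0r_neq0 d0)); rewrite divfK ?lt0r_neq0// /df mulrBl divfK ?lt0r_neq0//.
  by rewrite [dlogT _ _ _ * _]mulrC dlogT_den; ring.
rewrite !normrM normfV [`|den _ _|]gtr0_norm// [`|r|]ger0_norm// normrX normrN.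
rewrite [`|c|]ger0_norm// ger0_norm//.
have T1 : `|(chebT N.+1).[t] + c * (chebT N).[t]| <= 2.
  apply: (le_trans (ler_normD _ _)); rewrite normrM [`|c|]ger0_norm//.
  have c1 : c <= 1 by rewrite ltW// (le_lt_trans cr').
  have := lerD (chebT_bound N.+1 _ t1)
    (ler_pM c0 (normr_ge0 _) c1 (chebT_bound N _ t1)).
  by rewrite mulr1 -[X in _ <= X -> _](natrD _ 1 1).
have r1' : 0 < (1 - r) ^+ 2 by rewrite exprn_gt0// subr_gt0.
have dd : (1 - r) ^+ 2 <= den t c.
  apply: le_trans (den_ge _ _ t1 c0).
  apply: lerXn2r; rewrite ?nnegrE ?subr_ge0 ?lerD2l ?lerN2//; first exact: ltW.
  by rewrite ltW// (le_lt_trans cr').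
have cN : c ^+ N <= r ^+ N by apply: lerXn2r; rewrite ?nnegrE.
have c0N : 0 <= c ^+ N by rewrite exprn_ge0.
set A := `|_ + _| in T1 *; have A0 : 0 <= A by exact: normr_ge0.
have num : 2 * c ^+ N * A <= 4 * r ^+ N.
  rewrite (_ : 4 * r ^+ N = 2 * r ^+ N * 2); last by ring.
  by apply: ler_pM => //; [rewrite mulr_ge0|rewrite ler_pM2l].
have idd : (den t c)^-1 <= ((1 - r) ^+ 2)^-1 by rewrite lef_pV2 ?posrE.
rewrite -[leRHS]mulr1; apply: ler_pM => //; last exact: ltW.
  by rewrite !mulr_ge0// invr_ge0 ltW.
by apply: ler_pM => //; [rewrite !mulr_ge0|rewrite invr_ge0 ltW].
Qed.

End LogSeries.

Lemma geometric_bound_eq0 (R : realType) (a K r : R) : 0 <= r < 1 ->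
  (forall N, `|a| <= K * r ^+ N) -> a = 0.
Proof.
move=> /andP[r0 r1] aK; apply/normr0_eq0/eqP; rewrite eq_le normr_ge0 andbT.
have h : (fun N => K * r ^+ N) @ \oo --> (0 : R).
  by apply: cvg_geometric; rewrite ger0_norm.
rewrite -(cvg_lim _ h)//; apply: limr_ge; first by apply/cvg_ex; exists 0.
by apply: nearW => N; exact: aK.
Qed.

Section LogMean.
Context {R : realType}.
Local Notation mR := (measurableTypeR R).
Local Notation Q := ((mR * mR) * (mR * mR))%type.
Local Notation S3 := (@S3 R).
Variable s : FiniteMeasure.type Q R.
Hypothesis s_inv : forall g : quat R, qsq g = 1 -> mpreserving s (qmul g : Q -> Q).
Hypothesis sS3C : s (~` S3) = 0%E.
Hypothesis s_q1 : s [set x : Q | q1 x = 0] = 0%E.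
Local Notation V := (fine (s setT)).
Local Notation Ex := (Ex s).

Lemma measurable_ln_q0 (a b : R) :
  measurable_fun setT (fun x : Q => ln (a + b * q0 x) : mR).
Proof.
apply: (measurableT_comp (@measurable_ln R)).
apply: measurable_funD; first exact: measurable_cst.
by apply: measurable_funM; [exact: measurable_cst|exact: measurable_q0].
Qed.

Let lnr (r : R) (x : quat R) : R := ln ((1 + r ^+ 2) + 2 * r * q0 x).

Let lnrE r x : lnr r x = ln (1 + 2 * r * q0 x + r ^+ 2).
Proof. by rewrite /lnr; congr ln; ring. Qed.

Let bm_lnr r : 0 <= r < 1 -> bdd_mfun (lnr r).
Proof.
move=> r01; split; first exact: measurable_ln_q0.
exists (4 / (1 - r) ^+ 2) => x /S3_coord[x1 _ _ _].
have := logT_approx 0 _ _ x1 r01.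
by rewrite /logT big_ord0 subr0 expr0 mulr1 lnrE.
Qed.

(** Only T_2 contributes: its coefficient is - r^2 and its mean - V / 2. At least two terms are
    taken so that it occurs. *)
Lemma Ex_logT N r : Ex (fun x => logT N.+2 (q0 x) r) = r ^+ 2 / 2 * V.
Proof.
have bT n : bdd_mfun (fun x => - (2 * (- r) ^+ n.+1 / n.+1%:R) * (chebT n.+1).[@q0 R x]).
  by apply: bdd_mfunZ; exact: bdd_mfun_horner.
rewrite /logT (Ex_sum s sS3C); last by move=> n; exact: bT.
rewrite big_ord_recl big_ord_recl big1 => [|n _]; last first.
  rewrite ExZ; last exact: bdd_mfun_horner.
  by rewrite !lift0 (Ex_chebT s s_inv sS3C) mulr0.
rewrite !ExZ; [|exact: bdd_mfun_horner|exact: bdd_mfun_horner].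
rewrite !lift0 /= (Ex_chebT1 s s_inv) (Ex_chebT2 s s_inv sS3C) addr0 mulr0 add0r.
by field.
Qed.

(** The mean of the partial sums does not depend on N, while their error decays geometrically, so
    the difference is exactly 0. *)
Lemma Ex_lnr r : 0 <= r < 1 -> Ex (lnr r) = r ^+ 2 / 2 * V.
Proof.
move=> r01; apply/eqP; rewrite -subr_eq0; apply/eqP.
have [r0 r1] := andP r01.
apply: (geometric_bound_eq0 _ _ (4 * r ^+ 2 / (1 - r) ^+ 2 * V) _ r01) => N.
rewrite -(Ex_logT N r).
have bL : bdd_mfun (fun x => logT N.+2 (@q0 R x) r).
  by apply: bdd_mfun_sum => n; apply: bdd_mfunZ; exact: bdd_mfun_horner.
rewrite -ExB//; last exact: bm_lnr.
rewrite [leRHS](_ : _ = 4 * r ^+ N.+2 / (1 - r) ^+ 2 * V); last first.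
  by rewrite (_ : r ^+ N.+2 = r ^+ N * r ^+ 2); [ring|rewrite -exprD addn2].
apply: (Ex_le_bound s sS3C); first by apply: bdd_mfunB => //; exact: bm_lnr.
by move=> x /S3_coord[x1 _ _ _]; rewrite lnrE; exact: logT_approx.
Qed.

(* Removes in particular x = -1, where ln |1 + x| is infinite but Rocq's [ln 0] is 0. *)
Definition S3r : set Q := S3 `\` [set x | q1 x = 0].

Lemma measurable_S3r : measurable S3r.
Proof.
apply: measurableD; first exact: measurable_S3.
rewrite -[X in measurable X]setTI.
exact: (measurable_q1 measurableT [set (0 : R)] (measurable_set1 (0 : R))).
Qed.

Let measurable_q1_0 : measurable [set x : Q | q1 x = 0].
Proof.
rewrite -[X in measurable X]setTI.
exact: (measurable_q1 measurableT [set (0 : R)] (measurable_set1 (0 : R))).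
Qed.

Lemma ge0_integral_S3r (h : Q -> \bar R) : measurable_fun setT h ->
  (forall x, S3 x -> 0 <= h x)%E ->
  (\int[s]_(x in S3) h x = \int[s]_(x in S3r) h x)%E.
Proof.
move=> mh h0.
exact: (ge0_negligible_integral measurable_q1_0 measurable_S3 (measurable_funTS mh) h0 s_q1).
Qed.

(** On the sphere q0 = -1 forces the other coordinates to vanish, and points with q1 = 0 have been
    removed. *)
Lemma S3r_q0 (x : quat R) : S3r x -> -1 < q0 x <= 1.
Proof.
move=> [Sx /= x1]; have [q01 _ _ _] := S3_coord x Sx.
move: q01; rewrite ler_norml => /andP[h1 ->]; rewrite andbT lt_neqAle h1 andbT.
apply/eqP => e; apply: x1; move: Sx; rewrite /S3 /= /qsq -e => Sx.
apply/eqP; rewrite -sqrf_eq0; apply/eqP.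
have := (sqr_ge0 (q1 x), sqr_ge0 (q2 x), sqr_ge0 (q3 x)).
by move=> [[? ?] ?]; lra.
Qed.

Lemma EFin_Ex f : bdd_mfun f -> (\int[s]_(x in S3) (f x)%:E)%E = (Ex f)%:E.
Proof.
move=> bf; rewrite /Ex /Rintegral fineK//; apply: integrable_fin_num.
  exact: measurable_S3.
exact: bdd_mfun_integrable.
Qed.

(** Increases to 1 from 1/2; staying away from 0 keeps 1 / rho at most 2. *)
Let rho (n : nat) : R := 1 - (n.+2%:R)^-1.

Let rho_ge n : 2^-1 <= rho n.
Proof.
rewrite /rho lerBrDr addrC -lerBrDr (_ : 1 - 2^-1 = 2^-1); last by field.
by rewrite lef_pV2 ?posrE// ler_nat.
Qed.

Let rho_lt n : rho n < 1.
Proof. by rewrite /rho ltrBlDr ltrDl invr_gt0. Qed.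

Let rho_mono m n : (m <= n)%N -> rho m <= rho n.
Proof. by move=> mn; rewrite lerD2l lerN2 lef_pV2 ?posrE// ler_nat. Qed.

Let rho_cvg : rho @ \oo --> (1 : R).
Proof.
rewrite -[X in _ --> X]subr0; apply: cvgB; first exact: cvg_cst.
have := @cvg_harmonic R; rewrite -(cvg_shiftS (@harmonic R)).
by apply: cvg_trans.
Qed.

(** 1 + 2 r t + r^2 = r w(r, t). Unlike the left side, w decreases in r on (0, 1] for every t,
    because 1/r + r does. Along [rho] it is at most 2 + 1 + 2, so the ample constant 8 makes [gn]
    nonnegative and increasing in n, as monotone convergence requires. *)
Let w (r t : R) := r^-1 + r + 2 * t.
Let gn (n : nat) (x : quat R) : R := ln 8 - ln (w (rho n) (q0 x)).

Let rho01 n : 0 <= rho n < 1.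
Proof. by rewrite rho_lt andbT (le_trans _ (rho_ge n))// invr_ge0. Qed.

Let rho_gt0 n : 0 < rho n.
Proof. by rewrite (lt_le_trans _ (rho_ge n))// invr_gt0. Qed.

Let w_le8 n t : t <= 1 -> w (rho n) t <= 8.
Proof.
move=> t1; rewrite /w.
have : (rho n)^-1 <= 2 by rewrite -[leRHS]invrK lef_pV2 ?posrE ?invr_gt0// rho_gt0.
by have := rho_lt n; lra.
Qed.

Let w_mono m n t : (m <= n)%N -> w (rho n) t <= w (rho m) t.
Proof.
move=> mn; rewrite /w lerD2r -subr_ge0.
have [a0 b0] := (rho_gt0 m, rho_gt0 n).
have ab := rho_mono _ _ mn.
have [a1 b1] := (rho_lt m, rho_lt n).
rewrite (_ : _ - _ = (rho n - rho m) * (1 - rho m * rho n) / (rho m * rho n)); last first.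
  by field; rewrite !gt_eqF.
have ab1 : rho m * rho n <= 1 by rewrite -[leRHS]mulr1 ler_pM// ltW.
apply: divr_ge0; last by apply: mulr_ge0; exact: ltW.
by apply: mulr_ge0; rewrite subr_ge0.
Qed.

Let gnE n x : S3 x -> gn n x = (ln 8 + ln (rho n)) - lnr (rho n) x.
Proof.
move=> /S3_coord[+ _ _ _]; rewrite ler_norml => /andP[t1 _].
have r0 := rho_gt0 n.
have wE : (1 + rho n ^+ 2) + 2 * rho n * q0 x = rho n * w (rho n) (q0 x).
  by rewrite /w; field; rewrite gt_eqF.
have w0 : 0 < w (rho n) (q0 x).
  rewrite -(pmulr_rgt0 _ r0) -wE.
  have := rho_lt n; nra.
by rewrite /gn /lnr wE lnM ?posrE//; ring.
Qed.

Let w_S3 n x : S3 x -> 0 < w (rho n) (q0 x) <= 8.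
Proof.
move=> /S3_coord[+ _ _ _]; rewrite ler_norml => /andP[t1 t2].
rewrite w_le8// andbT; have r0 := rho_gt0 n.
rewrite -(pmulr_rgt0 _ r0) (_ : _ * _ = (1 - rho n) ^+ 2 + 2 * rho n * (1 + q0 x)).
  rewrite ltr_wpDr ?exprn_gt0 ?subr_gt0//.
  by rewrite !mulr_ge0 ?(ltW r0)//; lra.
by rewrite /w; field; rewrite gt_eqF.
Qed.

Let measurable_gn n : measurable_fun setT (fun x : Q => (gn n x)%:E).
Proof.
apply/measurable_EFinP; apply: measurable_funB; first exact: measurable_cst.
exact: measurable_ln_q0.
Qed.

Let gn_ge0 n x : S3 x -> (0 <= (gn n x)%:E)%E.
Proof.
move=> Sx; have /andP[w0 w8] := w_S3 n x Sx.
by rewrite lee_fin subr_ge0 ler_ln ?posrE.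
Qed.

Let int_gn n : (\int[s]_(x in S3r) (gn n x)%:E)%E =
  (((ln 8 + ln (rho n)) - rho n ^+ 2 / 2) * V)%:E.
Proof.
rewrite -(ge0_integral_S3r _ (measurable_gn n) (gn_ge0 n)).
have b1 := bm_lnr _ (rho01 n).
transitivity (\int[s]_(x in S3) ((ln 8 + ln (rho n)) - lnr (rho n) x)%:E)%E.
  by apply: eq_integral => x /set_mem Sx; rewrite gnE.
rewrite EFin_Ex; last by apply: bdd_mfunB => //; exact: bdd_mfun_cst.
rewrite ExB//; last exact: bdd_mfun_cst.
by rewrite (Ex_cst s sS3C) Ex_lnr// -mulrBl.
Qed.

Let gn_cvg x : S3r x -> (gn n x)%:E @[n --> \oo] --> (ln 8 - ln (2 + 2 * q0 x))%:E.
Proof.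
move=> /S3r_q0/andP[t1 _]; apply/cvg_EFin; first exact: nearW.
apply: cvgB; first exact: cvg_cst.
have h : w (rho n) (q0 x) @[n --> \oo] --> 2 + 2 * q0 x.
  rewrite /w; apply: cvgD; last exact: cvg_cst.
  rewrite (_ : 2 = 1^-1 + 1); last by rewrite invr1.
  by apply: cvgD => //; apply: cvgV => //; exact: oner_neq0.
apply: (continuous_cvg _ _ h).
by apply: continuous_ln; lra.
Qed.

Lemma ge0_integral_ln_S3r :
  (\int[s]_(x in S3r) (ln 8 - ln (2 + 2 * q0 x))%:E)%E = ((ln 8 - 1 / 2) * V)%:E.
Proof.
have := @cvg_monotone_convergence _ Q _ s _ measurable_S3r (fun n x => (gn n x)%:E)
  (fun n => measurable_funTS (measurable_gn n)) (fun n x Dx => gn_ge0 n x Dx.1).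
move=> /(_ _)/cvg_lim => lim_int.
transitivity (\int[s]_(x in S3r) limn (fun n => (gn n x)%:E))%E.
  by apply: eq_integral => x /set_mem Dx; apply/esym/cvg_lim => //; exact: gn_cvg.
rewrite -lim_int//.
  apply: cvg_lim => //.
  under eq_cvg do rewrite int_gn.
  apply/cvg_EFin; first exact: nearW.
  apply: cvgM; last exact: cvg_cst.
  rewrite -[X in _ --> X - _]addr0 -(@ln1 R).
  apply: cvgB.
    apply: cvgD; first exact: cvg_cst.
    apply: (continuous_cvg _ _ rho_cvg).
    exact: continuous_ln.
  apply: cvgM; last exact: cvg_cst.
  by rewrite -[X in _ --> X]mulr1; exact: (cvgM rho_cvg rho_cvg).
move=> x Dx m n mn; rewrite lee_fin lerD2l lerN2.
have /andP[wn _] := w_S3 n x Dx.1; have /andP[wm _] := w_S3 m x Dx.1.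
by rewrite ler_ln ?posrE// w_mono.
Qed.

End LogMean.

(** * Conjugation, triangle inequality and polar form of quaternions *)

Section QuatNorm.
Context {R : realType}.
Implicit Types p q g x : quat R.

Definition qconj q : quat R := qmk (q0 q) (- q1 q) (- q2 q) (- q3 q).

Lemma qsq_qconj q : qsq (qconj q) = qsq q.
Proof. by rewrite /qsq /qconj /qmk /q0 /q1 /q2 /q3 /=; ring. Qed.

Lemma qsqD p q : qsq (qadd p q) = qsq p + qsq q + 2 * q0 (qmul p (qconj q)).
Proof. by rewrite /qsq /qadd /qmul /qconj /qmk /q0 /q1 /q2 /q3 /=; ring. Qed.

Lemma q0_qmulC p q : q0 (qmul p q) = q0 (qmul q p).
Proof. by rewrite /qmul /qmk /q0 /q1 /q2 /q3 /=; ring. Qed.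

Lemma qmul_qconj_l g x : qsq g = 1 -> qmul g (qmul (qconj g) x) = x.
Proof.
move=> g1; rewrite qmulA.
have -> : qmul g (qconj g) = qmk 1 0 0 0.
  by apply: quat_eq; rewrite -?g1 /qsq /qmul /qconj /qmk /q0 /q1 /q2 /q3 /=; ring.
by apply: quat_eq; rewrite /qmul /qmk /q0 /q1 /q2 /q3 /=; ring.
Qed.

(** Holds at q = 0 too, where both logarithms are [ln 0] = 0. *)
Lemma ln_qnorm q : ln (qnorm q) = ln (qsq q) / 2.
Proof.
have [q0|q0] := eqVneq (qsq q) 0.
  by rewrite /qnorm -/(qsq q) q0 sqrtr0 ln0 ?mul0r.
have qp : 0 < qnorm q by rewrite sqrtr_gt0 lt_neqAle eq_sym q0 qsq_ge0.
rewrite -qnorm_sqr (_ : ln (qnorm q ^+ 2) = 2 * ln (qnorm q)); first by field.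
by rewrite lnXn// mulr_natl.
Qed.

(** The triangle inequality. Cauchy-Schwarz for the cross term says that the real part of p (conj q)
    is at most its norm |p| |q|. *)
Lemma qsqD_le p q : qsq (qadd p q) <= (qnorm p + qnorm q) ^+ 2.
Proof.
rewrite sqrrD !qnorm_sqr qsqD addrAC lerD2r lerD2l.
rewrite -[_ * _ *+ 2]mulr_natl ler_pM2l// (le_trans (ler_norm _))//.
rewrite -ler_sqr ?nnegrE ?mulr_ge0 ?sqrtr_ge0// real_normK ?num_real//.
rewrite exprMn !qnorm_sqr -(qsq_qconj q) -qsqM /qsq -!addrA lerDl.
by rewrite !addr_ge0 ?sqr_ge0.
Qed.

Lemma qscale_unit q : exists2 g, qsq g = 1 & q = qscale (qnorm q) g.
Proof.
have [n0|n0] := eqVneq (qnorm q) 0.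
  have z : qsq q = 0 by rewrite -qnorm_sqr n0 expr0n.
  exists (qmk 1 0 0 0); first by rewrite /qsq /qmk /q0 /q1 /q2 /q3 /=; ring.
  move: z; rewrite /qsq => z.
  have := (sqr_ge0 (q0 q), sqr_ge0 (q1 q), sqr_ge0 (q2 q), sqr_ge0 (q3 q)).
  move=> [[[h0 h1] h2] h3].
  by rewrite n0; apply: quat_eq; rewrite [RHS]mul0r; apply/eqP; rewrite -sqrf_eq0; apply/eqP; lra.
exists (qscale (qnorm q)^-1 q).
  by rewrite qsq_qscale exprVn -qnorm_sqr mulVf// sqrf_eq0.
by apply: quat_eq; rewrite /qscale /qmk /q0 /q1 /q2 /q3 /= mulrA divff// mul1r.
Qed.

End QuatNorm.

(** * Mean of log|x p + c| over one sphere *)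

Section AffineLogMean.
Context {R : realType}.
Local Notation mR := (measurableTypeR R).
Local Notation Q := ((mR * mR) * (mR * mR))%type.
Local Notation S3 := (@S3 R).
Local Notation S3r := (@S3r R).
Variable s : FiniteMeasure.type Q R.
Hypothesis s_inv : forall g : quat R, qsq g = 1 -> mpreserving s (qmul g : Q -> Q).
Hypothesis sS3C : s (~` S3) = 0%E.
Hypothesis s_q1 : s [set x : Q | q1 x = 0] = 0%E.
Local Notation V := (fine (s setT)).
Local Notation Ex := (Ex s).

Let fine_s_S3r : fine (s S3r) = V.
Proof.
rewrite -(s_S3 s sS3C); congr fine.
have := ge0_integral_S3r s s_q1 (cst 1%E) (measurable_cst _) (fun _ _ => lee01).
by rewrite !integral_cst ?mul1e//; [exact: measurable_S3r|exact: measurable_S3].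
Qed.

(** ln 8 - ln (2 + 2 q0) is nonnegative with finite integral, hence integrable; the integrand is a
    constant plus half of it. *)
Let integral_affine_ln (k : R) :
  (\int[s]_(x in S3r) (k - ln (2 + 2 * q0 x) / 2)%:E)%E = ((k - 1 / 4) * V)%:E.
Proof.
pose g (x : quat R) : R := ln 8 - ln (2 + 2 * q0 x).
have mg : measurable_fun setT (g : Q -> mR).
  by apply: measurable_funB; [exact: measurable_cst|exact: measurable_ln_q0].
have g0 x : S3r x -> 0 <= g x.
  move=> /S3r_q0/andP[t1 t2]; rewrite subr_ge0 ler_ln ?posrE//; lra.
have int_g : s.-integrable S3r (EFin \o g).
  apply/integrableP; split; first by apply/measurable_EFinP; exact: measurable_funTS.
  have -> : (\int[s]_(x in S3r) `|(EFin \o g) x| =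
      \int[s]_(x in S3r) (ln 8 - ln (2 + 2 * q0 x))%:E)%E.
    by apply: eq_integral => x /set_mem Dx /=; rewrite ger0_norm// g0.
  by rewrite (ge0_integral_ln_S3r s s_inv sS3C s_q1) ltry.
have int_c r : s.-integrable S3r (EFin \o (fun=> r)).
  by apply: finite_measure_integrable_cst; exact: measurable_S3r.
have mS3r := @measurable_S3r R.
have int_Z : s.-integrable S3r (EFin \o (fun x => 2^-1 * g x)).
  by have := integrableZl mS3r 2^-1 int_g; apply: eq_integrable.
have int_D : s.-integrable S3r (EFin \o (fun x => (k - ln 8 / 2) + 2^-1 * g x)).
  by have := integrableD mS3r (int_c (k - ln 8 / 2)) int_Z; apply: eq_integrable.
transitivity (\int[s]_(x in S3r) ((k - ln 8 / 2) + 2^-1 * g x)%:E)%E.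
  by apply: eq_integral => x _; congr EFin; rewrite /g; ring.
rewrite -[LHS]fineK; last exact: (integrable_fin_num mS3r int_D).
congr EFin; rewrite -[LHS]/(\int[s]_(x in S3r) ((k - ln 8 / 2) + 2^-1 * g x)).
rewrite (RintegralD mS3r (int_c _) int_Z) (RintegralZl 2^-1 mS3r int_g).
rewrite (Rintegral_cst s mS3r) fine_s_S3r.
rewrite /Rintegral (ge0_integral_ln_S3r s s_inv sS3C s_q1) /=; by field.
Qed.

(** Division by S^2 leaves the ratio r / S. If r < S, the logarithm is bounded on the sphere and
    [Ex_lnr] applies; if r = S, it is unbounded near -1 and the integral is moved to [S3r]. *)
Lemma mean_ln (S r C : R) : 0 <= r <= S -> 0 < S ->
  (forall x, S3 x -> ln ((S ^+ 2 + r ^+ 2) + 2 * S * r * q0 x) / 2 <= C) ->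
  (\int[s]_(x in S3) (C - ln ((S ^+ 2 + r ^+ 2) + 2 * S * r * q0 x) / 2)%:E)%E
  = ((C - ln S - r ^+ 2 / (4 * S ^+ 2)) * V)%:E.
Proof.
move=> /andP[r0 rS] S0 hC.
have lnE x : 0 < 1 + (r / S) ^+ 2 + 2 * (r / S) * q0 x ->
    ln ((S ^+ 2 + r ^+ 2) + 2 * S * r * q0 x) / 2 =
    ln S + ln (1 + (r / S) ^+ 2 + 2 * (r / S) * q0 x) / 2.
  move=> pos.
  have -> : (S ^+ 2 + r ^+ 2) + 2 * S * r * q0 x =
      S ^+ 2 * (1 + (r / S) ^+ 2 + 2 * (r / S) * q0 x).
    by field; rewrite gt_eqF.
  have l2 : ln (S ^+ 2) = 2 * ln S by rewrite lnXn// mulr_natl.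
  by rewrite lnM ?posrE ?exprn_gt0// l2; field.
have [rE|rneS] := eqVneq r S; last first.
  have rho1 : 0 <= r / S < 1.
    apply/andP; split; first by apply: divr_ge0 => //; exact: ltW.
    by rewrite ltr_pdivrMr// mul1r lt_neqAle rneS.
  have bl : bdd_mfun (fun x => ln (1 + (r / S) ^+ 2 + 2 * (r / S) * @q0 R x)).
    split; first exact: measurable_ln_q0.
    exists (4 / (1 - r / S) ^+ 2) => x /S3_coord[x1 _ _ _].
    have := logT_approx 0 _ _ x1 rho1.
    rewrite /logT big_ord0 subr0 expr0 mulr1; congr (`|ln _| <= _); ring.
  transitivity (\int[s]_(x in S3) ((C - ln S) -
      2^-1 * ln (1 + (r / S) ^+ 2 + 2 * (r / S) * q0 x))%:E)%E.
    apply: eq_integral => x /set_mem /S3_coord[+ _ _ _].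
    rewrite ler_norml => /andP[t1 t2]; congr EFin; rewrite lnE; first by ring.
    move/andP: rho1 => [h0 h1].
    have : 0 < (1 - r / S) ^+ 2 by rewrite exprn_gt0// subr_gt0.
    have : 0 <= (r / S) * (1 + q0 x) by rewrite mulr_ge0//; lra.
    lra.
  rewrite EFin_Ex; last by apply: bdd_mfunB; [exact: bdd_mfun_cst|exact: bdd_mfunZ].
  rewrite ExB; [|exact: bdd_mfun_cst|exact: bdd_mfunZ].
  rewrite (Ex_cst s sS3C) ExZ// (Ex_lnr s s_inv sS3C)//.
  by congr EFin; field; rewrite gt_eqF.
subst r.
rewrite (ge0_integral_S3r s s_q1); last 2 first.
- apply/measurable_EFinP; apply: measurable_funB; first exact: measurable_cst.
  by apply: measurable_funM; [exact: measurable_ln_q0|exact: measurable_cst].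
- by move=> x Sx; rewrite lee_fin subr_ge0; exact: hC.
transitivity (\int[s]_(x in S3r) ((C - ln S) - ln (2 + 2 * q0 x) / 2)%:E)%E.
  apply: eq_integral => x /set_mem /S3r_q0/andP[t1 t2]; congr EFin.
  rewrite lnE divff ?gt_eqF// expr1n mulr1; first by rewrite opprD addrA.
  by lra.
rewrite integral_affine_ln; congr EFin; congr (_ * _); field.
by rewrite gt_eqF.
Qed.

(** Only |p|^2 + |c|^2 and |p| |c| enter, so either of p, c may be the larger. Since the real part
    is cyclic, the cross term is the real part of p (conj c) x = S r g x, a left multiplication by a
    unit. *)
Lemma mean_ln_affine (p c : quat R) (S r C : R) : 0 <= r <= S -> 0 < S ->
  (qsq p = S ^+ 2 /\ qsq c = r ^+ 2) \/ (qsq p = r ^+ 2 /\ qsq c = S ^+ 2) ->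
  (forall x, S3 x -> ln (qnorm (qadd (qmul x p) c)) <= C) ->
  (\int[s]_(x in S3) (C - ln (qnorm (qadd (qmul x p) c)))%:E)%E
  = ((C - ln S - r ^+ 2 / (4 * S ^+ 2)) * V)%:E.
Proof.
move=> rS S0 pc hC; have /andP[r0 _] := rS.
pose H (x : quat R) := ln ((S ^+ 2 + r ^+ 2) + 2 * S * r * q0 x) / 2.
have [g g1 gE] := qscale_unit (qmul p (qconj c)).
have nW : qnorm (qmul p (qconj c)) = S * r.
  rewrite /qnorm -/(qsq _) qsqM qsq_qconj.
  have -> : qsq p * qsq c = (S * r) ^+ 2 by case: pc => [[-> ->]|[-> ->]]; ring.
  by rewrite sqrtr_sqr ger0_norm// mulr_ge0// ltW.
have HE x : S3 x -> ln (qnorm (qadd (qmul x p) c)) = H (qmul g x).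
  rewrite /S3 /= => x1; rewrite ln_qnorm /H qsqD qsqM x1 mul1r -qmulA q0_qmulC gE nW.
  congr (ln _ / 2); congr (_ + _); first by case: pc => [[-> ->]|[-> ->]]; ring.
  by rewrite /qscale /qmul /qmk /q0 /q1 /q2 /q3 /=; ring.
have HC x : S3 x -> H x <= C.
  move=> Sx; rewrite -(qmul_qconj_l g x g1) -HE; last first.
    by apply/S3_qmul; rewrite ?qsq_qconj.
  by apply: hC; apply/S3_qmul; rewrite ?qsq_qconj.
rewrite -(mean_ln S r C rS S0 HC).
rewrite -(ge0_integral_S3_qmul s s_inv (fun x => (C - H x)%:E) g g1).
- by apply: eq_integral => x /set_mem Sx; rewrite HE.
- apply/measurable_EFinP; apply: measurable_funB; first exact: measurable_cst.
  by apply: measurable_funM; [exact: measurable_ln_q0|exact: measurable_cst].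
- by move=> x Sx; rewrite lee_fin subr_ge0 HC.
Qed.

Lemma bdd_mfun_q0_qmul (w : quat R) : bdd_mfun (fun x => q0 (qmul w x)).
Proof.
rewrite (_ : (fun _ => _) = fun x =>
  ((q0 w * q0 x - q1 w * q1 x) - q2 w * q2 x) - q3 w * q3 x)//.
by do 3?[apply: bdd_mfunB]; apply: bdd_mfunZ;
  [exact: bdd_mfun_q0|exact: bdd_mfun_q1|exact: bdd_mfun_q2|exact: bdd_mfun_q3].
Qed.

(** The cross term is linear in y, so its mean vanishes under y -> - y. *)
Lemma Ex_qsq_affine (b : R) (c : quat R) :
  bdd_mfun (fun y => qsq (qadd (qscale b y) c)) /\
  Ex (fun y => qsq (qadd (qscale b y) c)) = (b ^+ 2 + qsq c) * V.
Proof.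
have qE y : S3 y -> qsq (qadd (qscale b y) c) =
    (b ^+ 2 + qsq c) + 2 * b * q0 (qmul (qconj c) y).
  rewrite /S3 /= => y1; rewrite qsqD qsq_qscale y1 mulr1; congr (_ + _).
  by rewrite /qscale /qmul /qconj /qmk /q0 /q1 /q2 /q3 /=; ring.
have bl := bdd_mfun_q0_qmul (qconj c).
have Ex0 : Ex (fun y => q0 (qmul (qconj c) y)) = 0.
  have m1 : qsq (qmk (-1) 0 0 0 : quat R) = 1.
    by rewrite /qsq /qmk /q0 /q1 /q2 /q3 /=; ring.
  have := Ex_qmul s s_inv _ _ m1 bl.
  rewrite (Ex_eq s _ (fun y => -1 * q0 (qmul (qconj c) y))); last first.
    by move=> y _; rewrite /qmul /qmk /q0 /q1 /q2 /q3 /=; ring.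
  by rewrite ExZ// => h; lra.
have ba : bdd_mfun (fun y => (b ^+ 2 + qsq c) + 2 * b * q0 (qmul (qconj c) y)).
  by apply: bdd_mfunD; [exact: bdd_mfun_cst|exact: bdd_mfunZ].
split.
  split; last by have [_ [M hM]] := ba; exists M => y Sy; rewrite qE// hM.
  apply: measurable_qsq; apply: measurable_qadd; last exact: measurable_cst.
  by apply: measurable_qmk; (apply: measurable_funM; first exact: measurable_cst);
    [exact: measurable_q0|exact: measurable_q1|exact: measurable_q2|exact: measurable_q3].
rewrite (Ex_eq s _ _ qE) ExD; [|exact: bdd_mfun_cst|exact: bdd_mfunZ].
by rewrite (Ex_cst s sS3C) ExZ// Ex0 mulr0 addr0.
Qed.

End AffineLogMean.

(** * Double mean and Mahler measure *)

Section DoubleMean.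
Context {R : realType}.
Local Notation mR := (measurableTypeR R).
Local Notation Q := ((mR * mR) * (mR * mR))%type.
Local Notation S3 := (@S3 R).
Variable s : FiniteMeasure.type Q R.
Hypothesis s_inv : forall g : quat R, qsq g = 1 -> mpreserving s (qmul g : Q -> Q).
Hypothesis sS3C : s (~` S3) = 0%E.
Hypothesis s_q1 : s [set x : Q | q1 x = 0] = 0%E.
Local Notation V := (fine (s setT)).
Local Notation Ex := (Ex s).

(** Real coefficients are central, which lets x be factored out on the left after y is replaced by x
    y. *)
Definition linreal (a b : R) (c x y : quat R) : quat R :=
  qadd (qadd (qscale a x) (qscale b y)) c.

Lemma measurable_qscale {d} {T : measurableType d} (r : R) (f : T -> Q) :
  measurable_fun setT f -> measurable_fun setT (fun x => qscale r (f x) : Q).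
Proof.
move=> mf; apply: measurable_qmk; (apply: measurable_funM; first exact: measurable_cst).
- exact: (measurableT_comp measurable_q0 mf).
- exact: (measurableT_comp measurable_q1 mf).
- exact: (measurableT_comp measurable_q2 mf).
- exact: (measurableT_comp measurable_q3 mf).
Qed.

Lemma qaddC (p q : quat R) : qadd p q = qadd q p.
Proof. by apply: quat_eq; rewrite /qadd /qmk /q0 /q1 /q2 /q3 /=; ring. Qed.

Variable C : R.

(* The absolute value makes the integrand nonnegative off the sphere too, so that
   Tonelli's theorem applies on the whole space; on the sphere C bounds the log. *)
Definition absdev (q : quat R) : \bar R := (`|C - ln (qnorm q)|)%:E.

Lemma measurable_absdev {d} {T : measurableType d} (f : T -> Q) :
  measurable_fun setT f -> measurable_fun setT (fun x => absdev (f x)).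
Proof.
move=> mf; apply/measurable_EFinP.
have mln : measurable_fun setT (fun x => ln (qnorm (f x))).
  by apply: (measurableT_comp (@measurable_ln R)); exact: measurable_qnorm.
have mB : measurable_fun setT (fun x => C - ln (qnorm (f x))).
  by apply: measurable_funB => //; exact: measurable_cst.
exact: (measurableT_comp (@normr_measurable R setT) mB).
Qed.

Lemma absdev_ge0 q : (0 <= absdev q)%E.
Proof. by rewrite lee_fin normr_ge0. Qed.

Let swap_int (F : Q -> Q -> Q) : measurable_fun setT (fun z : Q * Q => F z.1 z.2) ->
  (\int[s]_x \int[s]_y absdev (F x y) = \int[s]_y \int[s]_x absdev (F x y))%E.
Proof.
move=> mF.
exact: (fubini_tonelli (fun z => absdev (F z.1 z.2)) (measurable_absdev _ mF)
  (fun z => absdev_ge0 _)).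
Qed.

Let measurable_int (F : Q -> Q -> Q) : measurable_fun setT (fun z : Q * Q => F z.1 z.2) ->
  measurable_fun setT (fun x : Q => \int[s]_y absdev (F x y))%E.
Proof.
move=> mF.
exact: (measurable_fun_fubini_tonelli_F (fun z => absdev (F z.1 z.2))
  (measurable_absdev _ mF) (fun z => absdev_ge0 _)).
Qed.

Let outer_mean (S b : R) (c : quat R) : 0 < S ->
  (\int[s]_(y in S3) ((C - ln S - qsq (qadd (qscale b y) c) / (4 * S ^+ 2)) * V)%:E)%E
  = ((C - ln S - (b ^+ 2 + qsq c) / (4 * S ^+ 2)) * V ^+ 2)%:E.
Proof.
move=> S0; have [bq Eq] := Ex_qsq_affine s s_inv sS3C b c.
pose k := (4 * S ^+ 2)^-1 * V.
transitivity (\int[s]_(y in S3) ((C - ln S) * V - k * qsq (qadd (qscale b y) c))%:E)%E.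
  by apply: eq_integral => y _; congr EFin; rewrite /k; ring.
rewrite EFin_Ex; last by apply: bdd_mfunB; [exact: bdd_mfun_cst|exact: bdd_mfunZ].
rewrite ExB; [|exact: bdd_mfun_cst|exact: bdd_mfunZ].
by rewrite (Ex_cst s sS3C) ExZ// Eq /k; congr EFin; ring.
Qed.

Let measurable_pairs (F : Q -> Q -> Q) :
  measurable_fun setT (fun z : Q * Q => F z.1 z.2) ->
  measurable_fun setT (fun z : Q * Q => F z.2 z.1).
Proof. by move=> mF; exact: (measurableT_comp mF (@measurable_swap _ _ _ _)). Qed.

(* The general shape of all three cases: x p(y) + d(y), where the larger of
   |p(y)|, |d(y)| is the constant S and the square of the smaller one is affine in y. *)
Let mean_both (p d : Q -> quat R) (S b : R) (c : quat R) : 0 < S ->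
  measurable_fun setT (p : Q -> Q) -> measurable_fun setT (d : Q -> Q) ->
  (forall y, S3 y -> qnorm (qadd (qscale b y) c) <= S) ->
  (forall y, S3 y ->
    (qsq (p y) = S ^+ 2 /\ qsq (d y) = qsq (qadd (qscale b y) c)) \/
    (qsq (p y) = qsq (qadd (qscale b y) c) /\ qsq (d y) = S ^+ 2)) ->
  (forall x y, S3 x -> S3 y -> ln (qnorm (qadd (qmul x (p y)) (d y))) <= C) ->
  (\int[s]_x \int[s]_y absdev (qadd (qmul x (p y)) (d y)))%E
  = ((C - ln S - (b ^+ 2 + qsq c) / (4 * S ^+ 2)) * V ^+ 2)%:E.
Proof.
move=> S0 mp md hS hpd hC.
have mF : measurable_fun setT (fun z : Q * Q => qadd (qmul z.1 (p z.2)) (d z.2) : Q).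
  apply: measurable_qadd; last exact: (measurableT_comp md measurable_snd).
  apply: measurable_qmul; first exact: measurable_fst.
  exact: (measurableT_comp mp measurable_snd).
rewrite (swap_int (fun x y => qadd (qmul x (p y)) (d y)) mF).
have mG := measurable_int (fun y x => qadd (qmul x (p y)) (d y))
  (measurable_pairs (fun x y => qadd (qmul x (p y)) (d y)) mF).
rewrite -(ge0_integral_S3 s sS3C _ mG); last first.
  by move=> y; apply: integral_ge0 => x _; exact: absdev_ge0.
rewrite -(outer_mean S b c S0); apply: eq_integral => y /set_mem Sy.
have mx : measurable_fun setT (fun x : Q => absdev (qadd (qmul x (p y)) (d y))).
  apply: measurable_absdev; apply: measurable_qadd; last exact: measurable_cst.
  by apply: measurable_qmul; [exact: measurable_id|exact: measurable_cst].
rewrite -(ge0_integral_S3 s sS3C _ mx); last by move=> x; exact: absdev_ge0.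
rewrite -qnorm_sqr.
rewrite -(mean_ln_affine s s_inv sS3C s_q1 (p y) (d y) S (qnorm (qadd (qscale b y) c)) C).
- apply: eq_integral => x /set_mem Sx; rewrite /absdev ger0_norm// subr_ge0.
  exact: hC.
- by rewrite sqrtr_ge0 hS.
- exact: S0.
- by rewrite qnorm_sqr; exact: hpd.
- by move=> x Sx; exact: hC.
Qed.

Let linreal_mulr (a b : R) (c x y : quat R) :
  linreal a b c x y = qadd (qmul x (qmk a 0 0 0)) (qadd (qscale b y) c).
Proof.
by apply: quat_eq; rewrite /linreal /qscale /qadd /qmul /qmk /q0 /q1 /q2 /q3 /=; ring.
Qed.

Let linreal_shear (a b : R) (c x y : quat R) :
  linreal a b c x (qmul x y) = qadd (qmul x (qadd (qscale b y) (qmk a 0 0 0))) c.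
Proof.
by apply: quat_eq; rewrite /linreal /qscale /qadd /qmul /qmk /q0 /q1 /q2 /q3 /=; ring.
Qed.

Let qsq_real (a : R) : qsq (qmk a 0 0 0 : quat R) = a ^+ 2.
Proof. by rewrite /qsq /qmk /q0 /q1 /q2 /q3 /=; ring. Qed.

Let qnorm_scale_S3 (b : R) y : 0 <= b -> S3 y -> qnorm (qscale b y) = b.
Proof.
move=> b0; rewrite /S3 /= => y1.
by rewrite /qnorm -/(qsq _) qsq_qscale y1 mulr1 sqrtr_sqr ger0_norm.
Qed.

Let qnorm_affine_le (b : R) (c y : quat R) : 0 <= b -> S3 y ->
  qnorm (qadd (qscale b y) c) <= b + qnorm c.
Proof.
move=> b0 Sy; rewrite -ler_sqr ?nnegrE ?addr_ge0 ?sqrtr_ge0//.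
by rewrite qnorm_sqr; have := qsqD_le (qscale b y) c; rewrite qnorm_scale_S3.
Qed.

Let measurable_affine (b : R) (c : quat R) :
  measurable_fun setT (fun y : Q => qadd (qscale b y) c : Q).
Proof.
apply: measurable_qadd; last exact: measurable_cst.
by apply: measurable_qscale; exact: measurable_id.
Qed.

Let measurable_linreal (a b : R) (c : quat R) :
  measurable_fun setT (fun z : Q * Q => linreal a b c z.1 z.2 : Q).
Proof.
apply: measurable_qadd; last exact: measurable_cst.
by apply: measurable_qadd; apply: measurable_qscale;
  [exact: measurable_fst|exact: measurable_snd].
Qed.

Let mean_lead (a b : R) (c : quat R) : 0 < a -> 0 <= b -> b + qnorm c <= a ->
  (forall x y, S3 x -> S3 y -> ln (qnorm (linreal a b c x y)) <= C) ->
  (\int[s]_x \int[s]_y absdev (linreal a b c x y))%E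
  = ((C - ln a - (b ^+ 2 + qsq c) / (4 * a ^+ 2)) * V ^+ 2)%:E.
Proof.
move=> a0 b0 bca hC.
rewrite -(mean_both (fun=> qmk a 0 0 0) (fun y => qadd (qscale b y) c) a b c a0).
- by apply: eq_integral => x _; apply: eq_integral => y _; rewrite linreal_mulr.
- exact: measurable_cst.
- exact: measurable_affine.
- by move=> y Sy; rewrite (le_trans (qnorm_affine_le _ _ _ b0 Sy)).
- by move=> y Sy; left; rewrite qsq_real.
- by move=> x y Sx Sy; rewrite -linreal_mulr; exact: hC.
Qed.

Let mean_const (a b : R) (c : quat R) : 0 <= a -> 0 <= b -> 0 < qnorm c ->
  a + b <= qnorm c ->
  (forall x y, S3 x -> S3 y -> ln (qnorm (linreal a b c x y)) <= C) ->
  (\int[s]_x \int[s]_y absdev (linreal a b c x y))%E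
  = ((C - ln (qnorm c) - (b ^+ 2 + a ^+ 2) / (4 * qsq c)) * V ^+ 2)%:E.
Proof.
move=> a0 b0 c0 abc hC; rewrite -[qsq c]qnorm_sqr -(qsq_real a).
rewrite -(mean_both (fun y => qadd (qscale b y) (qmk a 0 0 0)) (fun=> c) _ _ _ c0).
- have mL := measurable_linreal a b c.
  have mS : measurable_fun setT
      (fun z : Q * Q => qadd (qmul z.1 (qadd (qscale b z.2) (qmk a 0 0 0))) c : Q).
    apply: measurable_qadd; last exact: measurable_cst.
    apply: measurable_qmul; first exact: measurable_fst.
    exact: (measurableT_comp (measurable_affine b (qmk a 0 0 0)) measurable_snd).
  have m1 := measurable_int (linreal a b c) mL.
  have m2 := measurable_int
    (fun x y => qadd (qmul x (qadd (qscale b y) (qmk a 0 0 0))) c) mS.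
  (* The outer integral is first restricted to [S3]: the inner substitution y -> x y preserves [s]
     when x is a unit. *)
  rewrite -(ge0_integral_S3 s sS3C _ m1); last first.
    by move=> y; apply: integral_ge0 => x _; exact: absdev_ge0.
  rewrite -[RHS](ge0_integral_S3 s sS3C _ m2); last first.
    by move=> y; apply: integral_ge0 => x _; exact: absdev_ge0.
  apply: eq_integral => x /set_mem Sx.
  have mx : measurable_fun setT (fun y : Q => absdev (linreal a b c x y)).
    apply: measurable_absdev.
    exact: (measurable_fun_pair2 x mL).
  have [_ inv] := s_inv x Sx.
  rewrite -(inv _ mx (fun y => absdev_ge0 _)).
  by apply: eq_integral => y _; rewrite linreal_shear.
- exact: measurable_affine.
- exact: measurable_cst.
- move=> y Sy; apply: (le_trans (qnorm_affine_le _ _ _ b0 Sy)).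
  by rewrite {1}/qnorm -/(qsq _) qsq_real sqrtr_sqr ger0_norm// addrC.
- by move=> y Sy; right; rewrite qnorm_sqr.
- move=> x y Sx Sy; rewrite -linreal_shear; apply: hC => //.
  by apply/S3_qmul.
Qed.

(** The three cases share one formula because the largest modulus contributes M^2 / (4 M^2) = 1/4 to
    the sum, which the last term removes. *)
Lemma mean_linreal (a b : R) (c : quat R) :
  let M := Num.max (Num.max a b) (qnorm c) in
  0 <= a -> 0 <= b -> 0 < M ->
  (b + qnorm c <= a \/ a + qnorm c <= b \/ a + b <= qnorm c) ->
  (forall x y, S3 x -> S3 y -> ln (qnorm (linreal a b c x y)) <= C) ->
  (\int[s]_x \int[s]_y absdev (linreal a b c x y))%E
  = ((C - (ln M + (a ^+ 2 + b ^+ 2 + qsq c) / (4 * M ^+ 2) - 1 / 4)) * V ^+ 2)%:E.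
Proof.
move=> M a0 b0 M0 tri hC; have c0 : 0 <= qnorm c by exact: sqrtr_ge0.
case: tri => [h|[h|h]].
- have ME : M = a by rewrite /M !max_l ?ler_wpDl//; lra.
  rewrite ME in M0 *; rewrite mean_lead//; congr EFin; field.
  by rewrite gt_eqF.
- have ME : M = b by rewrite /M (@max_r _ _ a) ?max_l//; lra.
  rewrite ME in M0 *.
  have swapE x y : linreal a b c x y = linreal b a c y x.
    by rewrite /linreal; congr qadd; exact: qaddC.
  transitivity (\int[s]_x \int[s]_y absdev (linreal b a c y x))%E.
    by apply: eq_integral => x _; apply: eq_integral => y _; rewrite swapE.
  have mF := measurable_pairs (linreal b a c) (measurable_linreal b a c).
  rewrite (swap_int (fun x y => linreal b a c y x) mF) mean_lead//.
    by congr EFin; field; rewrite gt_eqF.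
  by move=> x y Sx Sy; rewrite -swapE; exact: hC.
- have ME : M = qnorm c.
    rewrite /M max_r// ge_max (le_trans _ h) ?lerDl// (le_trans _ h)//.
    by rewrite lerDr.
  rewrite ME in M0 *; rewrite mean_const//; congr EFin; rewrite -qnorm_sqr; field.
  by rewrite gt_eqF.
Qed.

End DoubleMean.

(** * Quaternion coefficients and the passage to the ball integral *)

Section MahlerMean.
Context {R : realType}.
Local Notation mR := (measurableTypeR R).
Local Notation Q := ((mR * mR) * (mR * mR))%type.
Local Notation S3 := (@S3 R).

(** The real part of i x is - q1 x, so the unit i carries one hyperplane to the other. *)
Lemma q1_null (s : FiniteMeasure.type Q R) :
  (forall g : quat R, qsq g = 1 -> mpreserving s (qmul g : Q -> Q)) ->
  s [set x : Q | q0 x = 0] = 0%E -> s [set x : Q | q1 x = 0] = 0%E.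
Proof.
move=> s_inv s0; pose i : quat R := qmk 0 1 0 0.
have i1 : qsq i = 1 by rewrite /qsq /i /qmk /q0 /q1 /q2 /q3 /=; ring.
have [_ inv] := s_inv _ i1.
have m0 := @measurable_q0_eq R 0.
have m1 : measurable [set x : Q | q1 x = 0].
  rewrite -[X in measurable X]setTI.
  exact: (measurable_q1 measurableT [set (0 : R)] (measurable_set1 (0 : R))).
pose A := [set x : Q | q0 x = 0].
have m : measurable_fun setT (fun x : Q => (\1_A x)%:E : \bar R).
  by apply/measurable_EFinP; exact: measurable_indic.
have n0 (x : Q) : (0 <= (\1_A x)%:E :> \bar R)%E by rewrite lee_fin.
have <- : (\int[s]_x (\1_A (qmul i x))%:E)%E = s [set x : Q | q1 x = 0].
  have := integral_indic s measurableT m1; rewrite setIT => <-.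
  apply: eq_integral => x _; congr EFin; rewrite !indicE; congr (_%:R).
  have E : q0 (qmul i x) = - q1 x by rewrite /i /qmul /qmk /q0 /q1 /q2 /q3 /=; ring.
  congr nat_of_bool; apply/idP/idP => /set_mem h; apply/mem_set; move: h.
    by rewrite /A /= E => /eqP; rewrite oppr_eq0 => /eqP.
  by rewrite /A /= E => ->; rewrite oppr0.
by rewrite (inv _ m n0) (integral_indic s measurableT m0) setIT.
Qed.

Section LinPoly.
Variable s : FiniteMeasure.type Q R.
Hypothesis s_inv : forall g : quat R, qsq g = 1 -> mpreserving s (qmul g : Q -> Q).
Hypothesis sS3C : s (~` S3) = 0%E.
Hypothesis s_q1 : s [set x : Q | q1 x = 0] = 0%E.
Local Notation V := (fine (s setT)).
Variables (a b c : quat R) (C : R).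

Lemma measurable_linpoly {d} {T : measurableType d} (f g : T -> Q) :
  measurable_fun setT f -> measurable_fun setT g ->
  measurable_fun setT (fun x => linpoly a b c (f x) (g x) : Q).
Proof.
move=> mf mg; apply: measurable_qadd; last exact: measurable_cst.
apply: measurable_qadd; apply: measurable_qmul => //; exact: measurable_cst.
Qed.

Lemma mean_linpoly :
  let M := Num.max (Num.max (qnorm a) (qnorm b)) (qnorm c) in
  0 < M ->
  (qnorm b + qnorm c <= qnorm a \/ qnorm a + qnorm c <= qnorm b \/
   qnorm a + qnorm b <= qnorm c) ->
  (forall x y, S3 x -> S3 y -> ln (qnorm (linpoly a b c x y)) <= C) ->
  (\int[s]_x \int[s]_y absdev C (linpoly a b c x y))%E
  = ((C - (ln M + (qnorm a ^+ 2 + qnorm b ^+ 2 + qnorm c ^+ 2) / (4 * M ^+ 2) - 1 / 4))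
     * V ^+ 2)%:E.
Proof.
move=> M M0 tri hC.
have [ga ga1 aE] := qscale_unit a; have [gb gb1 bE] := qscale_unit b.
have linE x y : linpoly a b c x y =
    linreal (qnorm a) (qnorm b) c (qmul ga x) (qmul gb y).
  rewrite /linpoly /linreal {1}aE {1}bE; congr (qadd (qadd _ _) _);
  by apply: quat_eq; rewrite /qscale /qmul /qmk /q0 /q1 /q2 /q3 /=; ring.
have hC' x y : S3 x -> S3 y -> ln (qnorm (linreal (qnorm a) (qnorm b) c x y)) <= C.
  move=> Sx Sy; rewrite -(qmul_qconj_l ga x ga1) -(qmul_qconj_l gb y gb1) -linE.
  by apply: hC; apply/S3_qmul; rewrite ?qsq_qconj.
rewrite [qnorm c ^+ 2]qnorm_sqr.
rewrite -(mean_linreal s s_inv sS3C s_q1 C (qnorm a) (qnorm b) c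
  (sqrtr_ge0 _) (sqrtr_ge0 _) M0 tri hC').
have mlr : measurable_fun setT
    (fun z : Q * Q => linreal (qnorm a) (qnorm b) c z.1 z.2 : Q).
  apply: measurable_qadd; last exact: measurable_cst.
  by apply: measurable_qadd; apply: measurable_qscale;
    [exact: measurable_fst|exact: measurable_snd].
have mI := measurable_fun_fubini_tonelli_F
  (fun z : Q * Q => absdev C (linreal (qnorm a) (qnorm b) c z.1 z.2))
  (measurable_absdev C _ mlr) (fun z => absdev_ge0 C _) : measurable_fun setT
  (fun x : Q => \int[s]_y absdev C (linreal (qnorm a) (qnorm b) c x y))%E.
have [_ inva] := s_inv _ ga1; have [_ invb] := s_inv _ gb1.
rewrite -[RHS](inva _ mI); last first.
  by move=> x; apply: integral_ge0 => y _; exact: absdev_ge0.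
apply: eq_integral => x _.
have mx : measurable_fun setT
    (fun y : Q => absdev C (linreal (qnorm a) (qnorm b) c (qmul ga x) y)).
  by apply: measurable_absdev; exact: (measurable_fun_pair2 (qmul ga x) mlr).
rewrite -[RHS](invb _ mx (fun y => absdev_ge0 C _)).
by apply: eq_integral => y _; rewrite linE.
Qed.

End LinPoly.

(** The parallelogram law with |p - q|^2 dropped. *)
Let qsqD2 (p q : quat R) : qsq (qadd p q) <= 2 * (qsq p + qsq q).
Proof.
have := qsq_ge0 (qadd p (qscale (-1) q)).
rewrite (_ : qsq (qadd p (qscale _ _)) = 2 * (qsq p + qsq q) - qsq (qadd p q)).
  by rewrite subr_ge0.
by rewrite /qsq /qadd /qscale /qmk /q0 /q1 /q2 /q3 /=; ring.
Qed.

(** Two uses of |p + q|^2 <= 2 (|p|^2 + |q|^2) give the factor 4, and ln t <= t does the rest. The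
    arguments range over the ball because [qnormalize] sends 0 to 0, off the sphere. *)
Lemma ln_linpoly_le (a b c x y : quat R) : qsq x <= 1 -> qsq y <= 1 ->
  ln (qnorm (linpoly a b c x y)) <= 4 * (qsq a + qsq b + qsq c).
Proof.
move=> x1 y1; rewrite ln_qnorm; set q := linpoly _ _ _ _ _.
have q4 : qsq q <= 4 * (qsq a + qsq b + qsq c).
  apply: (le_trans (qsqD2 _ _)); have := qsqD2 (qmul a x) (qmul b y).
  have ax : qsq (qmul a x) <= qsq a by rewrite qsqM ler_piMr// qsq_ge0.
  have bx : qsq (qmul b y) <= qsq b by rewrite qsqM ler_piMr// qsq_ge0.
  have := qsq_ge0 c; lra.
apply: le_trans q4; have := qsq_ge0 q; rewrite le_eqVlt => /predU1P[<-|qp].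
  by rewrite ln0// mul0r.
have := ln_sublinear qp; lra.
Qed.

Lemma qsq_qnormalize_le (u : quat R) : qsq (qnormalize u) <= 1.
Proof.
rewrite qsq_qscale exprVn qnorm_sqr.
by have [->|u0] := eqVneq (qsq u) 0; rewrite ?mulr0// mulVf.
Qed.

End MahlerMean.

(** Links the single integral over the product of balls in [mahlerH] to iterated integrals over the
    sphere: Tonelli for the integrand extended by 0 outside D x D. *)
Lemma ge0_integral_setX_pushrestr {d d'} {T : measurableType d}
    {T' : measurableType d'} {R : realType}
    (m : {sigma_finite_measure set T -> \bar R}) (D : set T) (f : T -> T')
    (mD : measurable D) (mf : measurable_fun setT f) (Dlty : (m D < +oo)%E)
    (K : T' * T' -> \bar R) :
  measurable_fun setT K -> (forall z, 0 <= K z)%E ->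
  (\int[m \x m]_(z in D `*` D) K (f z.1, f z.2) =
   \int[pushrestr m D f mD mf Dlty]_x \int[pushrestr m D f mD mf Dlty]_y K (x, y))%E.
Proof.
move=> mK K0; set s := pushrestr m D f mD mf Dlty.
have intE h : measurable_fun setT h -> (forall x, 0 <= h x)%E ->
    (\int[s]_x h x = \int[m]_(x in D) h (f x))%E.
  exact: (ge0_integral_pushrestr m D f mD mf).
have mKf : measurable_fun setT (fun z : T * T => K (f z.1, f z.2)).
  apply: (measurableT_comp mK); apply: measurable_fun_pair.
    exact: (measurableT_comp mf measurable_fst).
  exact: (measurableT_comp mf measurable_snd).
have mDD : measurable (D `*` D) by exact: measurableX.
pose F := (fun z : T * T => K (f z.1, f z.2)) \_ (D `*` D).
have mF : measurable_fun setT F.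
  by apply/(measurable_restrictT _ mDD); exact: measurable_funTS.
have F0 z : (0 <= F z)%E by rewrite /F patchE; case: ifP.
rewrite integral_mkcond -/F (fubini_tonelli1 F mF F0).
have mI := measurable_fun_fubini_tonelli_F (m2 := s) K mK K0.
rewrite [RHS](intE (fun x => \int[s]_y K (x, y))%E mI); last first.
  by move=> x; apply: integral_ge0.
rewrite [RHS]integral_mkcond; apply: eq_integral => x _.
rewrite /fubini_F patchE; case: ifPn => [/set_mem Dx|Dx]; last first.
  apply: integral0_eq => y _; rewrite /F patchE; case: ifPn => // /set_mem[/= /mem_set].
  by rewrite (negbTE Dx).
rewrite (intE (fun y => K (f x, y)))//; last exact: measurable_fun_pair2.
rewrite [RHS]integral_mkcond; apply: eq_integral => y _.
rewrite /F !patchE /=; congr (if _ then _ else _).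
by apply/idP/idP => [/set_mem[_ /mem_set]//|/set_mem Dy]; exact/mem_set.
Qed.

(** C - f is nonnegative with finite integral, hence integrable; on a domain of finite measure so is
    f = C - (C - f), and the integrals subtract. *)
Lemma integral_of_gap {d} {T : measurableType d} {R : realType}
    (m : {measure set T -> \bar R}) (D : set T) (f : T -> R) (C v w : R) :
  measurable D -> m D = v%:E -> measurable_fun setT f ->
  (forall x, D x -> f x <= C) ->
  (\int[m]_(x in D) (C - f x)%:E)%E = (C * v - w)%:E ->
  (\int[m]_(x in D) (f x)%:E)%E = w%:E.
Proof.
move=> mD mDv mf fC gap.
have intC : m.-integrable D (EFin \o (fun=> C)).
  apply: measurable_bounded_integrable => //.
  - by rewrite mDv ltry.
  - exists `|C|; split; first exact: num_real.
    by move=> N CN x _ /=; exact: ltW.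
have mg : measurable_fun setT (fun x => C - f x).
  by apply: measurable_funB => //; exact: measurable_cst.
have intg : m.-integrable D (EFin \o (fun x => C - f x)).
  apply/integrableP; split; first by apply/measurable_EFinP; exact: measurable_funTS.
  have -> : (\int[m]_(x in D) `|(EFin \o (fun x => C - f x)%R) x| =
      \int[m]_(x in D) (C - f x)%:E)%E.
    by apply: eq_integral => x /set_mem Dx /=; rewrite ger0_norm// subr_ge0 fC.
  by rewrite gap ltry.
transitivity (\int[m]_(x in D) (C%:E - (C - f x)%R%:E))%E.
  by apply: eq_integral => x _; rewrite -EFinB subKr.
have := integralB_EFin mD intC intg; rewrite /= => ->.
by rewrite gap integral_cst// mDv -EFinM -EFinB subKr.
Qed.

Theorem theorem1p6 (R : realType) (a b c : quat R) :
  let M := Num.max (Num.max (qnorm a) (qnorm b)) (qnorm c) in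
  0 < M ->
  (qnorm b + qnorm c <= qnorm a \/ qnorm a + qnorm c <= qnorm b \/
   qnorm a + qnorm b <= qnorm c) ->
  mahlerH (linpoly a b c) =
  (ln M + (qnorm a ^+ 2 + qnorm b ^+ 2 + qnorm c ^+ 2) / (4 * M ^+ 2)
   - 1 / 4)%:E.
Proof.
move=> M M0 tri; set v := _ - 1 / 4.
pose C := 4 * (qsq a + qsq b + qsq c).
pose V := @svol R; have V0 : 0 < V := svol_gt0.
have hC x y : qsq x <= 1 -> qsq y <= 1 -> ln (qnorm (linpoly a b c x y)) <= C.
  exact: ln_linpoly_le.
pose Q := ((measurableTypeR R * measurableTypeR R) *
  (measurableTypeR R * measurableTypeR R))%type.
have mP : measurable_fun setT (fun z : Q * Q => linpoly a b c z.1 z.2 : Q).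
  by apply: measurable_linpoly; [exact: measurable_fst|exact: measurable_snd].
have S3le (x : quat R) : S3 x -> qsq x <= 1 by rewrite /S3 /= => ->.
have mean := mean_linpoly (@sph R) (@mpreserving_sph R) sph_S3C
  (q1_null _ (@mpreserving_sph R) sph_q0_eq0) a b c C M0 tri
  (fun x y Sx Sy => hC x y (S3le x Sx) (S3le y Sy)).
have sV : fine ((@sph R) setT) = V by rewrite sphT.
rewrite sV -/v in mean.
have E := ge0_integral_setX_pushrestr mleb4 (@qball R) (@qnormalize R : Q -> Q)
  measurable_qball measurable_qnormalize mleb4_qball_lty
  (fun z => absdev C (linpoly a b c z.1 z.2)) (measurable_absdev C _ mP)
  (fun z => absdev_ge0 C _).
have {mean}E := etrans E mean.
have mBB : measurable ((@qball R : set Q) `*` (@qball R : set Q)).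
  by apply: measurableX; exact: measurable_qball.
have mf : measurable_fun setT (fun z : Q * Q =>
    ln (qnorm (linpoly a b c (qnormalize z.1) (qnormalize z.2)))).
  apply: (measurableT_comp (@measurable_ln R)); apply: measurable_qnorm.
  by apply: measurable_linpoly; apply: (measurableT_comp measurable_qnormalize);
    [exact: measurable_fst|exact: measurable_snd].
have BB : (mleb4 \x mleb4)%E ((@qball R : set Q) `*` (@qball R : set Q)) = (V ^+ 2)%:E.
  rewrite product_measure1E; [|exact: measurable_qball|exact: measurable_qball].
  by rewrite mleb4_qball [X in (X * _)%E]mleb4_qball -EFinM -expr2.
have fC z : ((@qball R : set Q) `*` (@qball R : set Q)) z ->
    ln (qnorm (linpoly a b c (qnormalize z.1) (qnormalize z.2))) <= C.
  by move=> _; apply: hC; exact: qsq_qnormalize_le.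
have gap : (\int[mleb4 \x mleb4]_(z in (@qball R : set Q) `*` (@qball R : set Q))
    (C - ln (qnorm (linpoly a b c (qnormalize z.1) (qnormalize z.2))))%R%:E)%E =
    (C * V ^+ 2 - v * V ^+ 2)%:E.
  rewrite -mulrBl; apply: etrans E; apply: eq_integral => z _.
  apply: (congr1 EFin); apply/esym/ger0_norm.
  by rewrite subr_ge0; apply: hC; exact: qsq_qnormalize_le.
have I := integral_of_gap _ _ _ C (V ^+ 2) (v * V ^+ 2) mBB BB mf fC gap.
(* [leb4] and [mleb4] differ only in their packed structures, so this holds by conversion. *)
have VE : fine ((@leb4 R) (@qball R)) = V := erefl.
rewrite /mahlerH VE.
apply: (@etrans _ _ ((v * V ^+ 2)%:E * (V ^- 2)%:E)%E).
  by apply: (congr1 (fun t => t * (V ^- 2)%:E)%E); exact: I.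
have cancel (t : R) : t != 0 -> ((v * t)%:E * (t^-1)%:E)%E = v%:E.
  by move=> t0; rewrite -EFinM mulfK.
by apply: cancel; apply: expf_neq0; exact: lt0r_neq0.
Qed.
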